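(* There exist absolute constants $C_1,C_2>0$ with the following property. Let $\Omega\subset\mathbb{R}^d$ be compact, let $\mu$ be a probability measure on $\Omega$, and let $X_N$ be an $N$-dimensional subspace of real-valued continuous functions on $\Omega$ (also $N$-dimensional in $L_2(\Omega,\mu)$) which contains the constant function $1$. Then for every nonnegative integer $M$ there exists a set of $m$ points $\xi^1,\dots,\xi^m\in\Omega$ with $m\le C_1(M+N)N\log((M+N)N)$ such that for every $f\in X_N$ $$ \|f\|_\infty\le C_2\,\sigma_M^c(\mathcal{D}(X_N))_{(\infty,1)}\,\max_{1\le \nu\le m}|f(\xi^\nu)|. $$
   Context: $\|f\|_\infty=\max_{\mathbf x\in\Omega}|f(\mathbf x)|$, and $\|\cdot\|_1$ denotes the norm of $L_1(\Omega,\mu)$. Dirichlet kernel: if $\{u_j\}_{j=1}^N$ is an orthonormal basis of $X_N$ in $L_2(\Omega,\mu)$, then $\mathcal{D}(X_N)(\mathbf x,\mathbf y)=\mathcal D(X_N,\mathbf x,\mathbf y):=\sum_{j=1}^N u_j(\mathbf x)u_j(\mathbf y)$ (independent of the choice of orthonormal basis). Let $\mathcal{B}_M(X_N^\perp)$ be the set of all functions $\mathcal{W}(\mathbf x,\mathbf y)=\sum_{i=1}^M w_i(\mathbf x)v_i(\mathbf y)$ with $w_i\in\mathcal C(\Omega)$ (real continuous) and $v_i\in L_1(\Omega,\mu)$, $i=1,\dots,M$, such that for every $f\in X_N$ and every $\mathbf x\in\Omega$ one has $\int_\Omega\mathcal W(\mathbf x,\mathbf y)f(\mathbf y)\,d\mu(\mathbf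 y)=0$ (for $M=0$, $\mathcal B_0(X_N^\perp)=\{0\}$). For a continuous function $\mathcal K$ on $\Omega\times\Omega$, $$\sigma_M^c(\mathcal K)_{(\infty,1)}:=\inf_{\mathcal W\in\mathcal B_M(X_N^\perp)}\sup_{\mathbf x\in\Omega}\|\mathcal K(\mathbf x,\cdot)-\mathcal W(\mathbf x,\cdot)\|_1.$$
   Formalization: The formal theorem assumes (M+N)N > 1, which excludes only M = 0, N = 1; there the bound C_1(M+N)N log((M+N)N) is 0, so no points are allowed and the inequality fails for f = 1. *)

(* Defs.v *)
From HB Require Import structures.
From mathcomp Require Import all_boot all_order all_algebra.
From mathcomp Require Import all_classical all_reals all_analysis.
Set Implicit Arguments. Unset Strict Implicit. Unset Printing Implicit Defensive.
Import Order.TTheory GRing.Theory Num.Theory.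
Import numFieldNormedType.Exports.
Local Open Scope classical_set_scope.
Local Open Scope ring_scope.

Notation BorelRd R d := (g_sigma_algebraType (@open 'rV[R]_d)).

Section Defs.
Variables (R : realType) (d N : nat).
Variable (Omega : set 'rV[R]_d).
Variable (mu : probability (BorelRd R d) R).
Variable (u : 'I_N -> 'rV[R]_d -> R).

Definition spanf (c : 'I_N -> R) : 'rV[R]_d -> R :=
  fun x => \sum_(j < N) c j * u j x.

(* X_N := span of the u_j (as functions; only their values on Omega matter) *)
Definition XN : set ('rV[R]_d -> R) := [set f | exists c, f = spanf c].

(* Dirichlet kernel D(X_N)(x,y) = sum_j u_j(x) u_j(y) (u orthonormal basis) *)
Definition Dirichlet : 'rV[R]_d -> 'rV[R]_d -> R :=
  fun x y => \sum_(j < N) u j x * u j y.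

Definition BM (M : nat) : set ('rV[R]_d -> 'rV[R]_d -> R) :=
  [set W | exists (w v : 'I_M -> 'rV[R]_d -> R),
     [/\ (forall i, {within Omega, continuous (w i)}),
         (forall i, mu.-integrable Omega (fun y => (v i y)%:E)),
         (forall x y, W x y = \sum_(i < M) w i x * v i y) &
         (forall f, XN f -> forall x, Omega x ->
            (\int[mu]_(y in Omega) (W x y * f y)%:E = 0)%E)]].

Definition sigmaMc (M : nat) (K : 'rV[R]_d -> 'rV[R]_d -> R) : \bar R :=
  ereal_inf [set ereal_sup
                [set (\int[mu]_(y in Omega) (`|K x y - W x y|)%:E)%E | x in Omega]
            | W in BM M].

End Defs.

Definition supnorm (R : realType) (d : nat) (Omega : set 'rV[R]_d)
  (f : 'rV[R]_d -> R) : \bar R := ereal_sup [set (`|f x|)%:E | x in Omega].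

(* Main.v *)
(* Let [h_x = D(x, .) - W(x, .)] with W near-optimal.  Every f in X_N satisfies
   [f(x) = int h_x f], hence [|f(x)| <= int |h_x f|].  As X_N contains 1, both
   [h_x f] and [h_x] lie in the span of the n = (M+N)N products of the u_j, v_i
   with the u_k.  It therefore suffices to have O(n log n) points xi_k and weights
   t_k for which [sum_k t_k |g(xi_k)|] is comparable to [int |g|] on that span:
     |f(x)| <~ sum_k t_k |h_x(xi_k)| |f(xi_k)| <~ max_k |f(xi_k)| int |h_x|.
   A quadrature with a huge number of points comes from approximation by simple
   functions.  It is thinned by repeated halving: put the vectors of values in
   Lewis position, split the long ones, and keep the points where random signs
   are +1.  By the contraction principle the error of a halving is at most the
   supremum of a linear Rademacher process, which Lewis position turns into a
   maximum of K subgaussian variables of variance O(n/K), K being the number of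
   points.  The resulting errors sqrt(n log K / K) add up geometrically. *)

Require Import Defs.
From HB Require Import structures.
From mathcomp Require Import all_boot all_order all_algebra.
From mathcomp Require Import all_classical all_reals all_analysis.
From mathcomp Require Import zify ring lra.
Import Order.TTheory GRing.Theory Num.Theory.
Import numFieldNormedType.Exports.
Import HBSimple.
Local Open Scope classical_set_scope.
Local Open Scope ring_scope.

Set Implicit Arguments.
Unset Strict Implicit.
Unset Printing Implicit Defensive.

(** Lengths in Lewis position add up to the rank, so splitting K vectors costs at most K/2 extra
    pieces; half of 3K/2 is 3K/4, and a halving really loses points. The size of the initial
    quadrature is not controlled. The error allowed to a halving is therefore tied to the current
    number of points and not to the number of steps made: at (4/3)^j times the final size it is of
    order (19/20)^j, and the total stays below 1/2 for any start. The functions v_i are merely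
    integrable, so quadrature nodes cannot be arbitrary points; they are found by averaging. The
    resulting error is absolute, measured by the coefficients of the integrand. It becomes relative
    because the coefficients of f are bounded by its maximum, and f is examined at a point where |f|
    is maximal. The remaining additive losses, namely the slack in the choice of W and the
    quadrature error for |h_x|, disappear in a constant factor because sigma is at least 1: h_x
    reproduces the function 1. *)

(** * Exponential moments of Rademacher sums *)

Lemma cosh_le_expR (R : realType) (x : R) :
  expR x + expR (- x) <= 2 * expR (2 * x ^+ 2).
Proof.
(* The exponent [2 * x ^+ 2], four times the sharp one, permits an elementary proof:
   [expR x <= (1 - x)^-1] for small x, and [|x| <= 2 * x ^+ 2] for the others. *)
have [hx|hx] := leP (x ^+ 2) (1 / 2).
  have h1 : expR x <= (1 - x)^-1.
    have h := expR_ge1Dx (- x).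
    have hx1 : 0 < 1 - x by nra.
    rewrite -[x in expR x]opprK expRN lef_pV2 ?posrE ?expR_gt0 //.
  have h2 : expR (- x) <= (1 + x)^-1.
    have h := expR_ge1Dx x.
    have hx1 : 0 < 1 + x by nra.
    by rewrite expRN lef_pV2 ?posrE ?expR_gt0.
  have h3 := expR_ge1Dx (2 * x ^+ 2).
  have e1 : (1 - x)^-1 + (1 + x)^-1 = 2 / (1 - x ^+ 2).
    by field; apply/and3P; split; apply/eqP; nra.
  have hp : 0 < 1 - x ^+ 2 by nra.
  have h4 : 2 / (1 - x ^+ 2) <= 2 * (1 + 2 * x ^+ 2).
    by rewrite ler_pdivrMr //; nra.
  by nra.
have h1 : expR x <= expR (2 * x ^+ 2) by rewrite ler_expR; nra.
have h2 : expR (- x) <= expR (2 * x ^+ 2) by rewrite ler_expR; nra.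
lra.
Qed.

(** Independence of the signs: the sum over all patterns factorises over [J]. Expectations are
    written as unnormalised sums, with [2 ^+ #|J|] the number of patterns. *)
Lemma sum_expR_sign (R : realType) (J : finType) (b : J -> R) :
  \sum_(e : {ffun J -> bool}) expR (\sum_j (-1) ^+ e j * b j)
  <= 2 ^+ #|J| * expR (2 * \sum_j b j ^+ 2).
Proof.
have -> : \sum_(e : {ffun J -> bool}) expR (\sum_j (-1) ^+ e j * b j)
   = \sum_(e : {ffun J -> bool}) \prod_j expR ((-1) ^+ e j * b j).
  by apply: eq_bigr => e _; rewrite expR_sum.
rewrite -(bigA_distr_bigA (fun j (c : bool) => expR ((-1) ^+ c * b j))).
have -> : 2 ^+ #|J| * expR (2 * \sum_j b j ^+ 2) =
   \prod_j (2 * expR (2 * b j ^+ 2)).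
  by rewrite big_split /= prodr_const mulr_sumr expR_sum.
apply: ler_prod => j _.
rewrite sumr_ge0 /= => [|c _]; last exact: expR_ge0.
rewrite big_bool /= expr0 expr1 mul1r mulN1r addrC; exact: cosh_le_expR.
Qed.

(** * Contraction principle for absolute values *)

Definition supf (R : realType) (Z : Type) (P : set Z) (f : Z -> R) : R :=
  sup [set f z | z in P].

(** [sup] takes a default value on sets without a supremum. Boundedness on both sides is stable
    under the sign changes made below. *)
Definition bddf (R : realType) (Z : Type) (P : set Z) (f : Z -> R) :=
  exists B, forall z, P z -> `|f z| <= B.

Lemma le_supf (R : realType) (Z : Type) (P : set Z) (f : Z -> R) z :
  bddf P f -> P z -> f z <= supf P f.
Proof.
move=> [B hB] Pz; apply: ub_le_sup; last by exists z.
by exists B => _ [y Py <-]; apply: le_trans (hB y Py); exact: ler_norm.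
Qed.

Lemma supf_le (R : realType) (Z : Type) (P : set Z) (f : Z -> R) c :
  P !=set0 -> (forall z, P z -> f z <= c) -> supf P f <= c.
Proof.
move=> [z Pz] h; apply: ge_sup; first by exists (f z), z.
by move=> _ [y Py <-]; exact: h.
Qed.

Lemma bddfD (R : realType) (Z : Type) (P : set Z) (f g : Z -> R) :
  bddf P f -> bddf P g -> bddf P (fun z => f z + g z).
Proof.
move=> [A hA] [B hB]; exists (A + B) => z Pz.
by apply: le_trans (ler_normD _ _) _; rewrite lerD ?hA ?hB.
Qed.

Lemma bddfM_sign (R : realType) (Z : Type) (P : set Z) (f : Z -> R) (b : bool) :
  bddf P f -> bddf P (fun z => (-1) ^+ b * f z).
Proof. by move=> [B hB]; exists B => z Pz; rewrite normrMsign hB. Qed.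

Lemma bddf_norm (R : realType) (Z : Type) (P : set Z) (f : Z -> R) :
  bddf P f -> bddf P (fun z => `|f z|).
Proof. by move=> [B hB]; exists B => z Pz; rewrite normr_id hB. Qed.

Lemma bddf_sum (R : realType) (Z : Type) (P : set Z) (J : finType) (p : pred J)
    (f : J -> Z -> R) :
  (forall j, bddf P (f j)) -> bddf P (fun z => \sum_(j | p j) f j z).
Proof.
move=> /choice[B hB]; exists (\sum_(j | p j) B j) => z Pz.
by apply: le_trans (ler_norm_sum _ _ _) _; apply: ler_sum => j _; exact: hB.
Qed.

(* The two-point case of the contraction principle. *)
Lemma supf_add_abs (R : realType) (Z : Type) (P : set Z) (g h : Z -> R) :
  P !=set0 -> bddf P g -> bddf P h ->
  supf P (fun z => g z + `|h z|) + supf P (fun z => g z - `|h z|) <=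
  supf P (fun z => g z + h z) + supf P (fun z => g z - h z).
Proof.
move=> P0 bg bh; rewrite -lerBrDr; apply: supf_le => // z Pz.
rewrite lerBrDr addrC -lerBrDr; apply: supf_le => // y Py.
have bN : bddf P (fun z => - h z).
  by case: bh => B hB; exists B => x Px; rewrite normrN hB.
have l1 z' : P z' -> g z' + h z' <= supf P (fun z => g z + h z).
  by move=> Pz'; apply: (le_supf (f := fun z => g z + h z)) => //; exact: bddfD.
have l2 z' : P z' -> g z' - h z' <= supf P (fun z => g z - h z).
  by move=> Pz'; apply: (le_supf (f := fun z => g z - h z)) => //; exact: bddfD.
have := l1 _ Pz; have := l1 _ Py; have := l2 _ Pz; have := l2 _ Py.
by case: (ger0P (h z)) => ?; case: (ger0P (h y)) => ?; lra.
Qed.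

Section Contraction.
Variables (R : realType) (J : finType) (Z : Type) (P : set Z) (t : J -> Z -> R).
Hypotheses (P0 : P !=set0) (bt : forall j, bddf P (t j)).

Definition flip_sign (k : J) (e : {ffun J -> bool}) : {ffun J -> bool} :=
  [ffun j => (j == k) (+) e j].

Lemma flip_signK k : involutive (flip_sign k).
Proof. by move=> e; apply/ffunP => j; rewrite !ffunE addbA addbb. Qed.

(** With all signs but that of [k] frozen, [e] and [flip_sign k e] form a pair to which the
    two-point inequality applies; doubling the sum brings out the pairs. *)
Lemma sum_supf_swap (k : J) (f : J -> Z -> R) : (forall j, bddf P (f j)) ->
  \sum_(e : {ffun J -> bool})
     supf P (fun z => \sum_j (-1) ^+ e j * (if j == k then `|f j z| else f j z))
  <= \sum_(e : {ffun J -> bool}) supf P (fun z => \sum_j (-1) ^+ e j * f j z).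
Proof.
move=> bf.
have dbl (F : {ffun J -> bool} -> R) :
    2 * \sum_e F e = \sum_e (F e + F (flip_sign k e)).
  rewrite big_split /= [X in _ = _ + X](_ : _ = \sum_e F e) ?mulr2n; first by ring.
  by rewrite [RHS](reindex_inj (inv_inj (@flip_signK k))).
rewrite -(ler_pM2l (ltr0n R 2)) !dbl; apply: ler_sum => e _.
pose g z := \sum_(j | j != k) (-1) ^+ e j * f j z.
have bg : bddf P g by apply: bddf_sum => j; exact: bddfM_sign.
pose h z := (-1) ^+ e k * f k z.
have E1 (s : bool) : (fun z => \sum_j (-1) ^+ (if s then flip_sign k e else e) j * f j z)
   = (fun z => g z + (-1) ^+ s * h z).
  apply/funext => z; rewrite (bigD1 k) //= addrC; congr (_ + _).
    by apply: eq_bigr => j /negbTE jk; case: s; rewrite ?ffunE ?jk.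
  rewrite /h; case: s; rewrite ?ffunE ?eqxx /=; case: (e k) => /=;
    by rewrite ?expr0 ?expr1; ring.
have E2 (s : bool) : (fun z => \sum_j (-1) ^+ (if s then flip_sign k e else e) j *
     (if j == k then `|f j z| else f j z))
   = (fun z => g z + (-1) ^+ (s (+) e k) * `|h z|).
  apply/funext => z; rewrite (bigD1 k) //= addrC; congr (_ + _).
    by apply: eq_bigr => j /negbTE jk; rewrite jk; case: s; rewrite ?ffunE ?jk.
  by rewrite eqxx /h normrMsign; case: s; rewrite ?ffunE ?eqxx.
have := E1 false; have := E1 true; have := E2 false; have := E2 true.
move=> /= -> -> -> ->.
have bh : bddf P h by exact: bddfM_sign.
have := supf_add_abs P0 bg bh.
rewrite [(fun z => g z + `|h z|)](_ : _ = fun z => g z + (-1) ^+ false * `|h z|);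
  last by apply/funext => z; rewrite mul1r.
rewrite [(fun z => g z + h z)](_ : _ = fun z => g z + (-1) ^+ false * h z);
  last by apply/funext => z; rewrite mul1r.
rewrite [(fun z => g z - `|h z|)](_ : _ = fun z => g z + (-1) ^+ true * `|h z|);
  last by apply/funext => z; rewrite mulN1r.
rewrite [(fun z => g z - h z)](_ : _ = fun z => g z + (-1) ^+ true * h z);
  last by apply/funext => z; rewrite mulN1r.
by case: (e k) => //= hh; rewrite [leLHS]addrC.
Qed.

Lemma sum_supf_contraction :
  \sum_(e : {ffun J -> bool}) supf P (fun z => \sum_j (-1) ^+ e j * `|t j z|)
  <= \sum_(e : {ffun J -> bool}) supf P (fun z => \sum_j (-1) ^+ e j * t j z).
Proof.
(* Absolute values are removed one index at a time; [A] is the set of indices that still carry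
   one. *)
pose S (A : {set J}) := \sum_(e : {ffun J -> bool}) supf P
  (fun z => \sum_j (-1) ^+ e j * (if j \in A then `|t j z| else t j z)).
suff h A : S A <= S finset.set0.
  have E (A : {set J}) (g : J -> Z -> R) :
      (forall j z, (if j \in A then `|t j z| else t j z) = g j z) ->
      \sum_(e : {ffun J -> bool}) supf P (fun z => \sum_j (-1) ^+ e j * g j z) = S A.
    move=> gE; apply: eq_bigr => e _; congr supf; apply/funext => z.
    by apply: eq_bigr => j _; rewrite gE.
  have E1 := E finset.setT (fun j z => `|t j z|).
  have E0 := E finset.set0 t.
  rewrite E1 ?E0; first exact: h.
  - by move=> j z; rewrite finset.in_set0.
  - by move=> j z; rewrite finset.in_setT.
have [n] := ubnP #|A|; elim: n A => // n IH A ltAn.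
have [->//|[k kA]] := set_0Vmem A.
apply: le_trans (IH (A :\ k)%SET _); last by move: ltAn; rewrite (cardsD1 k) kA.
pose f j z := if j \in (A :\ k)%SET then `|t j z| else t j z.
have bf j : bddf P (f j).
  by rewrite /f; case: (j \in _); [exact: bddf_norm|exact: bt].
apply: le_trans (sum_supf_swap k bf); rewrite le_eqVlt; apply/orP; left.
apply/eqP; apply: eq_bigr => e _; congr supf; apply/funext => z.
apply: eq_bigr => j _; rewrite /f in_setD1.
by case: eqP => [->|_] /=; rewrite ?kA.
Qed.

End Contraction.

(** The zero of all [t j] makes every supremum [F e] nonnegative. Averaging gives [e] with
    [F e + F (neg e) <= 2 * d], so both suprema are at most [2 * d], and [F (neg e)] controls the
    negative deviations of [e]. Both patterns qualify; the one with fewer signs +1, encoded by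
    [false], is taken. *)
Lemma exists_balanced_sign (R : realType) (J : finType) (Z : Type) (P : set Z)
    (t : J -> Z -> R) (B : {ffun J -> bool} -> R) (d : R) :
  (forall j, bddf P (t j)) -> (exists2 z, P z & forall j, t j z = 0) ->
  (forall (e : {ffun J -> bool}) z, P z -> \sum_j (-1) ^+ e j * t j z <= B e) ->
  \sum_(e : {ffun J -> bool}) B e <= 2 ^+ #|J| * d ->
  exists e : {ffun J -> bool}, (#|[set j | ~~ e j]%SET| <= #|J|./2)%N /\
    forall z, P z -> `|\sum_j (-1) ^+ e j * `|t j z| | <= 2 * d.
Proof.
move=> bt [z0 Pz0 tz0] hB sB; have P0 : P !=set0 by exists z0.
pose F (e : {ffun J -> bool}) := supf P (fun z => \sum_j (-1) ^+ e j * `|t j z|).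
have bF (e : {ffun J -> bool}) : bddf P (fun z => \sum_j (-1) ^+ e j * `|t j z|).
  by apply: bddf_sum => j; apply: bddfM_sign; exact: bddf_norm.
have F0 e : 0 <= F e.
  apply: le_trans (le_supf (bF e) Pz0).
  by rewrite big1 // => j _; rewrite tz0 normr0 mulr0.
have sF : \sum_e F e <= 2 ^+ #|J| * d.
  apply: le_trans sB; apply: le_trans (sum_supf_contraction P0 bt) _.
  by apply: ler_sum => e _; apply: supf_le => // z Pz; exact: hB.
pose neg (e : {ffun J -> bool}) : {ffun J -> bool} := [ffun j => ~~ e j].
have negK : involutive neg by move=> e; apply/ffunP => j; rewrite !ffunE negbK.
have sF2 : \sum_e (F e + F (neg e)) <= 2 ^+ #|J| * (2 * d).
  rewrite big_split /= [X in _ + X](_ : _ = \sum_e F e).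
    by rewrite mulrCA mulr_natl mulr2n lerD.
  by rewrite [RHS](reindex_inj (inv_inj negK)).
have [e he] : exists e, F e + F (neg e) <= 2 * d.
  apply/not_existsP => hN; move: sF2; apply/negP; rewrite -ltNge.
  have -> : 2 ^+ #|J| * (2 * d) = \sum_(e : {ffun J -> bool}) 2 * d.
    by rewrite sumr_const card_ffun card_bool -[RHS]mulr_natl natrX.
  apply: ltr_sum => [|e _]; last by rewrite ltNge; apply/negP; exact: hN.
  by apply/hasP; exists [ffun=> true]; rewrite ?mem_index_enum.
have h1 (c : {ffun J -> bool}) z : F c + F (neg c) <= 2 * d -> P z ->
    `|\sum_j (-1) ^+ c j * `|t j z| | <= 2 * d.
  move=> hc Pz; have := le_supf (bF c) Pz; have := le_supf (bF (neg c)) Pz.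
  rewrite -![supf _ _]/(F _).
  have -> : \sum_j (-1) ^+ neg c j * `|t j z| = - \sum_j (-1) ^+ c j * `|t j z|.
    rewrite -sumrN; apply: eq_bigr => j _.
    by rewrite ffunE signrN mulNr.
  have := F0 c; have := F0 (neg c) => *.
  by rewrite ler_norml; apply/andP; split; lra.
have cc : (#|[set j | ~~ e j]%SET| + #|[set j | ~~ neg e j]%SET| = #|J|)%N.
  rewrite -(cardsC [set j | ~~ e j]%SET); congr (_ + _)%N.
  by apply: eq_card => j; rewrite !inE ffunE.
have [le|gt] := leqP #|[set j | ~~ e j]%SET| #|J|./2.
  by exists e; split => // z; exact: h1.
exists (neg e); split; last by move=> z; apply: h1; rewrite negK addrC.
rewrite -leq_double; have := odd_double_half #|J|.
by move: gt cc; rewrite -!muln2; case: (odd #|J|) => /= *; lia.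
Qed.

(** * Lewis position by maximising a determinant *)

Lemma continuous_sumR (R : realType) (T : topologicalType) (I : finType)
    (f : I -> T -> R) :
  (forall i, continuous (f i)) -> continuous (fun x => \sum_i f i x).
Proof.
move=> cf x; apply: cvg_big => [|i _]; last exact: cf.
exact: add_continuous.
Qed.

Lemma continuous_prodR (R : realType) (T : topologicalType) (I : finType)
    (f : I -> T -> R) :
  (forall i, continuous (f i)) -> continuous (fun x => \prod_i f i x).
Proof.
move=> cf x; apply: cvg_big => [|i _]; last exact: cf.
exact: (@mul_continuous R).
Qed.

Lemma continuous_mulR (R : realType) (T : topologicalType) (f g : T -> R) :
  continuous f -> continuous g -> continuous (fun x => f x * g x).
Proof. by move=> cf cg x; apply: cvgM; [exact: cf|exact: cg]. Qed.

Definition enorm (R : realType) (n : nat) (v : 'rV[R]_n) : R :=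
  Num.sqrt (\sum_j v 0 j ^+ 2).

Section Enorm.
Variables (R : realType) (n : nat).
Implicit Types v : 'rV[R]_n.

Lemma enorm_ge0 v : 0 <= enorm v. Proof. exact: sqrtr_ge0. Qed.

Lemma sqr_enorm v : enorm v ^+ 2 = \sum_j v 0 j ^+ 2.
Proof. by rewrite sqr_sqrtr // sumr_ge0 // => j _; exact: sqr_ge0. Qed.

Lemma enormZ c v : enorm (c *: v) = `|c| * enorm v.
Proof.
rewrite /enorm -sqrtr_sqr -sqrtrM ?sqr_ge0 // mulr_sumr.
by congr Num.sqrt; apply: eq_bigr => j _; rewrite mxE exprMn.
Qed.

Lemma enorm_coord v j : `|v 0 j| <= enorm v.
Proof.
rewrite -sqrtr_sqr ler_wsqrtr // (bigD1 j) //= lerDl.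
by apply: sumr_ge0 => i _; exact: sqr_ge0.
Qed.

Lemma enorm_eq0 v : enorm v = 0 -> v = 0.
Proof.
move=> v0; apply/rowP => j; rewrite mxE; apply/eqP; rewrite -normr_le0 -v0.
exact: enorm_coord.
Qed.

Lemma enorm0 : enorm (0 : 'rV[R]_n) = 0.
Proof. by have := enormZ 0 0; rewrite scale0r normr0 mul0r. Qed.

End Enorm.

Section LewisPosition.
Variables (R : realType) (I : finType) (r : nat) (a : I -> 'rV[R]_r).

Definition mass (T : 'M[R]_r) : R := \sum_k enorm (a k *m T).

(** Lewis position in the L_1 sense means that this matrix is the identity. Vectors with
    [a k *m T = 0] contribute 0, since the inverse of 0 is 0. *)
Definition lewis_form (T : 'M[R]_r) (i j : 'I_r) : R :=
  \sum_k (enorm (a k *m T))^-1 * ((a k *m T) 0 i * (a k *m T) 0 j).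

Lemma mass_ge0 T : 0 <= mass T.
Proof. by apply: sumr_ge0 => k _; exact: enorm_ge0. Qed.

Lemma massZ c T : mass (c *: T) = `|c| * mass T.
Proof.
by rewrite /mass mulr_sumr; apply: eq_bigr => k _; rewrite -scalemxAr enormZ.
Qed.

Lemma continuous_entry_vec_mx (k : I) (j : 'I_r) :
  continuous (fun v : 'rV[R]_(r * r) => (a k *m vec_mx v) 0 j).
Proof.
have -> : (fun v : 'rV[R]_(r * r) => (a k *m vec_mx v) 0 j) =
    (fun v => \sum_i a k 0 i * v 0 (mxvec_index i j)).
  by apply/funext => v; rewrite mxE; apply: eq_bigr => i _; rewrite mxE.
apply: continuous_sumR => i; apply: continuous_mulR.
  exact: cst_continuous.
exact: coord_continuous.
Qed.

Lemma continuous_mass : continuous (fun v : 'rV[R]_(r * r) => mass (vec_mx v)).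
Proof.
apply: continuous_sumR => k x.
have c : continuous (fun v : 'rV[R]_(r * r) => \sum_j (a k *m vec_mx v) 0 j ^+ 2).
  apply: continuous_sumR => j; under eq_fun do rewrite expr2.
  by apply: continuous_mulR; exact: continuous_entry_vec_mx.
exact: (continuous_comp (c x) (@sqrt_continuous R _)).
Qed.

Lemma continuous_det_vec_mx :
  continuous (fun v : 'rV[R]_(r * r) => `|\det (vec_mx v : 'M[R]_r)|).
Proof.
have c : continuous (fun v : 'rV[R]_(r * r) => \det (vec_mx v : 'M[R]_r)).
  apply: continuous_sumR => s; apply: continuous_mulR.
    exact: cst_continuous.
  apply: continuous_prodR => i; under eq_fun do rewrite mxE.
  exact: coord_continuous.
by move=> x; exact: (continuous_comp (c x) (@norm_continuous _ R _)).
Qed.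

Hypothesis span_a : exists l : 'I_r -> I -> R,
  forall i j, \sum_k l i k * a k 0 j = (i == j)%:R.

(** The dual system [l] recovers [T] from the vectors [a k *m T]. This bounds the set over which the
    determinant is maximised. *)
Lemma mass_coercive : exists B, forall (T : 'M[R]_r) i j, `|T i j| <= B * mass T.
Proof.
case: span_a => l hl.
have [B hB] : exists B, forall i k, `|l i k| <= B.
  exists (\sum_i \sum_k `|l i k|) => i k.
  rewrite (bigD1 i) //= (bigD1 k) //= -addrA lerDl addr_ge0 //.
    by apply: sumr_ge0 => *.
  by apply: sumr_ge0 => *; apply: sumr_ge0.
exists B => T i j.
have -> : T i j = \sum_k l i k * (a k *m T) 0 j.
  transitivity (\sum_p (\sum_k l i k * a k 0 p) * T p j).
    rewrite (bigD1 i) //= hl eqxx mul1r big1 ?addr0 // => p pi.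
    by rewrite hl eq_sym (negbTE pi) mul0r.
  under eq_bigr do rewrite mulr_suml.
  rewrite exchange_big /=; apply: eq_bigr => k _.
  by rewrite mxE mulr_sumr; apply: eq_bigr => p _; rewrite mulrA.
apply: le_trans (ler_norm_sum _ _ _) _; rewrite mulr_sumr.
by apply: ler_sum => k _; rewrite normrM ler_pM ?enorm_coord.
Qed.

(* A maximiser of |det| under a mass bound is, up to scaling, in Lewis position. *)
Lemma exists_max_det : (0 < r)%N ->
  exists T, [/\ T \in unitmx, mass T <= 1 &
    forall C, mass C <= 1 -> `|\det C| <= `|\det T|].
Proof.
move=> r0; pose Q := [set v : 'rV[R]_(r * r) | mass (vec_mx v) <= 1].
have [B hB] := mass_coercive.
have B0 : 0 <= B.
  pose i0 := Ordinal r0.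
  have := hB 1%:M i0 i0; rewrite mxE eqxx normr1 => h.
  have := mass_ge0 1%:M => h1; rewrite leNgt; apply/negP => h2; nra.
have cQ : compact Q.
  apply: bounded_closed_compact.
    exists B; split; first exact: num_real.
    move=> x Bx v Qv; rewrite /Num.norm /= mx_normrE.
    apply: bigmax_le => [|[i j] _]; first exact: ltW (le_lt_trans B0 Bx).
    rewrite /= ord1; case/mxvec_indexP: j => p q.
    have := hB (vec_mx v) p q; rewrite mxE => /le_trans -> //.
    by apply: le_trans (ltW Bx); rewrite ler_piMr.
  apply: (@preimage_closed _ _ (fun v : 'rV[R]_(r * r) => mass (vec_mx v))
     [set x | x <= 1]); last exact: closed_le.
  by move=> v _; exact: continuous_mass.
have Q0 c T : `|c| * mass T <= 1 -> Q (mxvec (c *: T)).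
  by rewrite /Q /= mxvecK massZ.
(* A small multiple of the identity is admissible and has nonzero determinant, hence so has the
   maximiser. *)
pose c := (1 + mass 1%:M)^-1.
have c0 : 0 < c by rewrite invr_gt0 ltr_pwDl // mass_ge0.
have Qc : Q (mxvec (c *: 1%:M)).
  apply: Q0; rewrite gtr0_norm // mulrC ler_pdivrMr ?ltr_pwDl ?mass_ge0 //.
  by rewrite mul1r lerDr.
have [v vQ vmax] := @compact_EVT_max _ R (fun v : 'rV[R]_(r * r) =>
  `|\det (vec_mx v : 'M[R]_r)|) Q (ex_intro _ _ Qc) cQ
  (continuous_subspaceT continuous_det_vec_mx).
exists (vec_mx v); split; last 2 first.
- by move: vQ; rewrite inE.
- move=> C hC; have := vmax (mxvec C); rewrite mxvecK; apply.
  by rewrite inE /Q /= mxvecK.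
have := vmax (mxvec (c *: 1%:M)); rewrite inE => /(_ Qc).
rewrite mxvecK detZ det1 mulr1 normrX gtr0_norm // => h.
rewrite unitmxE unitfE -normr_gt0; apply: lt_le_trans h.
exact: exprn_gt0.
Qed.

Lemma lewis_formZ c T i j : 0 < c ->
  lewis_form (c *: T) i j = c * lewis_form T i j.
Proof.
move=> c0; rewrite /lewis_form mulr_sumr; apply: eq_bigr => k _.
rewrite -scalemxAr enormZ gtr0_norm // !mxE invfM; set e := (enorm _)^-1.
by field; rewrite gt_eqF.
Qed.

Lemma lewis_form_trace T : \sum_i lewis_form T i i = mass T.
Proof.
rewrite exchange_big /=; apply: eq_bigr => k _; rewrite -mulr_sumr.
under eq_bigr do rewrite -expr2.
rewrite -sqr_enorm; have [->|e0] := eqVneq (enorm (a k *m T)) 0.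
  by rewrite invr0 mul0r.
by field.
Qed.

(* AM-GM in the form [|bC| <= (|bC|^2 / |b| + |b|) / 2]: near a maximiser of
   the determinant, the mass is bounded by a quadratic function of C. *)
Lemma mass_mul_le T C :
  2 * mass (T *m C) <=
  \sum_k (enorm (a k *m T))^-1 * (\sum_j (a k *m T *m C) 0 j ^+ 2) + mass T.
Proof.
rewrite /mass -big_split /= mulr_sumr; apply: ler_sum => k _.
rewrite -sqr_enorm mulmxA.
have [e0|e0] := eqVneq (enorm (a k *m T)) 0.
  by rewrite e0 (enorm_eq0 e0) mul0mx enorm0; lra.
have := enorm_ge0 (a k *m T); rewrite le_eqVlt eq_sym (negbTE e0) /= => ep.
set x := enorm (a k *m T *m C); set e := enorm _ in ep e0 *.
have -> : e^-1 * x ^+ 2 + e = (x ^+ 2 + e ^+ 2) / e by field.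
by rewrite ler_pdivlMr //; have := sqr_ge0 (x - e); nra.
Qed.

Lemma lewis_position : (0 < r)%N -> exists T, T \in unitmx /\
  forall i j, lewis_form T i j = (i == j)%:R.
Proof.
move=> r0; have [T [Tu T1 Tmax]] := exists_max_det r0.
have detT : 0 < `|\det T| by rewrite normr_gt0 -unitfE -unitmxE.
have massC C : `|\det C| = 1 -> 1 <= mass (T *m C).
  move=> dC; rewrite leNgt; apply/negP => lt1.
  (* The value 1/2 only keeps [q] positive. As [q < 1], dividing by it would push the determinant
     above the maximum. *)
  pose q := Num.max (mass (T *m C)) (1 / 2).
  have q0 : 0 < q by rewrite lt_max; apply/orP; right; lra.
  have q1 : q < 1 by rewrite gt_max lt1; lra.
  have : mass (q^-1 *: (T *m C)) <= 1.
    rewrite massZ gtr0_norm ?invr_gt0 // mulrC ler_pdivrMr // mul1r.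
    by rewrite le_max lexx.
  move/Tmax; rewrite detZ det_mulmx !normrM dC mulr1 leNgt => /negP; apply.
  rewrite ltr_pMl // normrX ger0_norm ?invr_ge0 1?ltW //.
  by rewrite exprn_egt1 -?lt0n // invf_gt1.
have mT : mass T = 1.
  apply/eqP; rewrite eq_le T1 /= -[T]mulmx1; apply: massC.
  by rewrite det1 normr1.
pose b k := a k *m T.
pose al := lewis_form T.
have quad C : `|\det C| = 1 ->
    1 <= \sum_k (enorm (b k))^-1 * (\sum_j (b k *m C) 0 j ^+ 2).
  by move=> /massC h; have := mass_mul_le T C; rewrite mT; lra.
have al0 i : 0 <= al i i.
  apply: sumr_ge0 => k _; rewrite mulr_ge0 ?invr_ge0 ?enorm_ge0 //.
  by rewrite -expr2 sqr_ge0.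
have tr1 : \sum_k (enorm (b k))^-1 * (\sum_j (b k) 0 j ^+ 2) = 1.
  rewrite -mT -lewis_form_trace [RHS]exchange_big /=; apply: eq_bigr => k _.
  by rewrite mulr_sumr; apply: eq_bigr => j _; rewrite expr2.
have alb i j : al i j = \sum_k (enorm (b k))^-1 * ((b k) 0 i * (b k) 0 j) by [].
clearbody b.
have pert C (p : I -> R) : `|\det C| = 1 ->
    (forall k, \sum_j (b k *m C) 0 j ^+ 2 = \sum_j (b k) 0 j ^+ 2 + p k) ->
    0 <= \sum_k (enorm (b k))^-1 * p k.
  move=> /quad h hp; move: h.
  under eq_bigr do rewrite hp mulrDr.
  by rewrite big_split /= tr1; lra.
have off (i j : 'I_r) : (j < i)%N -> al i j = 0.
  move=> ji; have nij : i != j by apply: contraTneq ji => ->; rewrite ltnn.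
  have h s : 0 <= 2 * s * al i j + s ^+ 2 * al i i.
    have := @pert (1%:M + s *: delta_mx i j)
      (fun k => 2 * s * ((b k) 0 i * (b k) 0 j) + s ^+ 2 * ((b k) 0 i * (b k) 0 i)).
    rewrite det_trig; last first.
      apply/is_trig_mxP => p q pq; rewrite !mxE.
      have -> : (p == q) = false by apply: contraTF pq => /eqP ->; rewrite ltnn.
      have [/= /eqP pi|] := boolP (p == i); last by rewrite /= mulr0 addr0.
      have -> : (q == j) = false.
        by apply: contraTF pq => /eqP ->; rewrite pi -leqNgt ltnW.
      by rewrite mulr0 addr0.
    have -> : \prod_p (1%:M + s *: delta_mx i j : 'M[R]_r) p p = 1.
      apply: big1 => p _; rewrite !mxE eqxx.
      have [/= /eqP ->|] := boolP (p == i); last by rewrite /= mulr0 addr0.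
      by rewrite (negbTE nij) mulr0 addr0.
    rewrite normr1 => /(_ erefl) hh.
    rewrite !alb !mulr_sumr -big_split /=.
    apply: le_trans (hh _) _.
      move=> k.
      have E p : (b k *m (1%:M + s *: delta_mx i j)) 0 p =
          (b k) 0 p + s * ((b k) 0 i * (p == j)%:R).
        rewrite mulmxDr mulmx1 -scalemxAr 2!mxE; congr (_ + s * _).
        rewrite mxE (bigD1 i) //= [delta_mx i j i p]mxE eqxx /= big1 ?addr0 //.
        by move=> q qi; rewrite mxE (negbTE qi) mulr0.
      rewrite (bigD1 j) //= [in RHS](bigD1 j) //= E eqxx mulr1.
      rewrite (eq_bigr (fun p => (b k) 0 p ^+ 2)) => [|p pj]; first by ring.
      by rewrite E (negbTE pj) !mulr0 addr0.
    by apply: ler_sum => k _; rewrite le_eqVlt; apply/orP; left; apply/eqP; ring.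
  (* Close to the minimiser in [s] of the quadratic; the added 1 excludes a zero denominator. *)
  have := h (- al i j / (1 + al i i)); have := al0 i => ai.
  have -> : 2 * (- al i j / (1 + al i i)) * al i j +
     (- al i j / (1 + al i i)) ^+ 2 * al i i =
     - (al i j ^+ 2 * (2 + al i i)) / (1 + al i i) ^+ 2.
    by field; rewrite gt_eqF //; lra.
  rewrite pmulr_lge0; last by rewrite invr_gt0 exprn_gt0 //; lra.
  rewrite oppr_ge0 pmulr_lle0; last lra.
  by rewrite le_eqVlt ltNge sqr_ge0 orbF sqrf_eq0 => /eqP.
have diag (i j : 'I_r) : i != j -> al j j <= al i i.
  move=> nij.
  have h y : 0 < y -> 0 <= (y - 1) * al i i + (y^-1 - 1) * al j j.
    move=> y0; pose c := Num.sqrt y.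
    have c0 : 0 < c by rewrite sqrtr_gt0.
    have c2 : c ^+ 2 = y by rewrite sqr_sqrtr // ltW.
    pose D : 'rV[R]_r := \row_p (if p == i then c else if p == j then c^-1 else 1).
    have := @pert (diag_mx D)
      (fun k => (y - 1) * ((b k) 0 i * (b k) 0 i) + (y^-1 - 1) * ((b k) 0 j * (b k) 0 j)).
    rewrite det_diag (bigD1 i) //= (bigD1 j) 1?eq_sym //= big1; last first.
      by move=> p /andP[pi pj]; rewrite mxE (negbTE pi) (negbTE pj).
    rewrite !mxE !eqxx eq_sym (negbTE nij) mulr1 divff ?gt_eqF // normr1.
    move=> /(_ erefl) hh; rewrite !alb !mulr_sumr -big_split /=.
    apply: le_trans (hh _) _.
      move=> k; rewrite (bigD1 i) //= (bigD1 j) 1?eq_sym //=.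
      rewrite [in RHS](bigD1 i) //= [in RHS](bigD1 j) 1?eq_sym //=.
      have E p : (b k *m diag_mx D) 0 p = (b k) 0 p * D 0 p.
        by rewrite mul_mx_diag mxE.
      rewrite (eq_bigr (fun p => (b k) 0 p ^+ 2)); last first.
        by move=> p /andP[pi pj]; rewrite E mxE (negbTE pi) (negbTE pj) mulr1.
      rewrite !E !mxE !eqxx [j == i]eq_sym (negbTE nij) -c2.
      by field; rewrite gt_eqF.
    by apply: ler_sum => k _; rewrite le_eqVlt; apply/orP; left; apply/eqP; ring.
  rewrite leNgt; apply/negP => lt; have a0 := al0 i; have b0 := al0 j.
  have s0 : 0 < al i i + al j j by lra.
  have j0 : 0 < al j j by lra.
  (* This [y] turns the right-hand side of [h] into a negative multiple of the square of
     [al j j - al i i]. *)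
  have := h (2 * al j j / (al i i + al j j)) _.
  rewrite divr_gt0 ?mulr_gt0 // => /(_ isT).
  have -> : (2 * al j j / (al i i + al j j) - 1) * al i i +
     ((2 * al j j / (al i i + al j j))^-1 - 1) * al j j =
     - (al j j - al i i) ^+ 2 / (2 * (al i i + al j j)).
    by field; rewrite !gt_eqF.
  rewrite pmulr_lge0 ?invr_gt0 ?mulr_gt0 // oppr_ge0 => h2.
  have : 0 < (al j j - al i i) ^+ 2 by rewrite exprn_gt0 // subr_gt0.
  lra.
have alE i : al i i = r%:R^-1.
  have : \sum_j al j j = 1 by rewrite lewis_form_trace.
  rewrite (eq_bigr (fun=> al i i)); last first.
    move=> j _; have [->//|nji] := eqVneq j i.
    by apply/eqP; rewrite eq_le !diag // eq_sym.
  rewrite sumr_const card_ord => h.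
  have rn : r%:R != 0 :> R by rewrite pnatr_eq0 -lt0n.
  by apply: (mulIf rn); rewrite mulr_natr h mulVf.
exists (r%:R *: T); split.
  by rewrite unitmxZ // unitfE pnatr_eq0 -lt0n.
move=> i j; rewrite lewis_formZ ?ltr0n // -/(al i j).
have [->|nij] := eqVneq i j; first by rewrite alE divff // pnatr_eq0 -lt0n.
have [lt|gt|/val_inj/eqP] := ltngtP j i; last by rewrite eq_sym (negbTE nij).
  by rewrite off // mulr0.
have -> : al i j = al j i.
  by rewrite !alb; apply: eq_bigr => k _; congr (_ * _); rewrite mulrC.
by rewrite off // mulr0.
Qed.

End LewisPosition.

(** * Halving a family in Lewis position *)

Definition dotp (R : realType) (n : nat) (u v : 'rV[R]_n) : R :=
  \sum_l u 0 l * v 0 l.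

Lemma dotpC (R : realType) (n : nat) (u v : 'rV[R]_n) : dotp u v = dotp v u.
Proof. by apply: eq_bigr => l _; rewrite mulrC. Qed.

Lemma dotpZl (R : realType) (n : nat) c (u v : 'rV[R]_n) :
  dotp (c *: u) v = c * dotp u v.
Proof. by rewrite mulr_sumr; apply: eq_bigr => l _; rewrite mxE mulrA. Qed.

Lemma dotpZr (R : realType) (n : nat) c (u v : 'rV[R]_n) :
  dotp u (c *: v) = c * dotp u v.
Proof. by rewrite dotpC dotpZl dotpC. Qed.

Lemma dotp_suml (R : realType) (n : nat) (J : finType) (u : J -> 'rV[R]_n) v :
  dotp (\sum_j u j) v = \sum_j dotp (u j) v.
Proof.
rewrite exchange_big /=; apply: eq_bigr => l _.
by rewrite summxE mulr_suml.
Qed.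

Lemma dotpE (R : realType) (n : nat) (u v : 'rV[R]_n) : dotp u v = (u *m v^T) 0 0.
Proof. by rewrite mxE; apply: eq_bigr => l _; rewrite mxE. Qed.

Lemma dotp_mulmx (R : realType) (n p : nat) (u : 'rV[R]_n) (A : 'M[R]_(n, p)) (v : 'rV[R]_p) :
  dotp (u *m A) v = dotp u (v *m A^T).
Proof. by rewrite !dotpE trmx_mul trmxK mulmxA. Qed.

Lemma dotp0l (R : realType) (n : nat) (v : 'rV[R]_n) : dotp 0 v = 0.
Proof. by rewrite dotpE mul0mx mxE. Qed.

Section LewisHalving.
Variables (R : realType) (I : finType) (r : nat) (b : I -> 'rV[R]_r) (K : nat).
Hypothesis lew : forall i j,
  \sum_k (enorm (b k))^-1 * (b k 0 i * b k 0 j) = (i == j)%:R.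
Hypothesis bK : (#|[set k | b k != 0%R]%SET| <= K)%N.
Hypotheses (r0 : (0 < r)%N) (K0 : (0 < K)%N).

Let rR : 0 < r%:R :> R. Proof. by rewrite ltr0n. Qed.
Let KR : 0 < K%:R :> R. Proof. by rewrite ltr0n. Qed.

(** The Lewis condition read as a resolution of the identity by the vectors [b k]. *)
Lemma lewis_dotp x y :
  \sum_k (enorm (b k))^-1 * (dotp x (b k) * dotp (b k) y) = dotp x y.
Proof.
transitivity (\sum_l \sum_m (x 0 l * y 0 m) * (l == m)%:R); last first.
  apply: eq_bigr => l _; rewrite (bigD1 l) //= eqxx mulr1 big1 ?addr0 // => m ml.
  by rewrite eq_sym (negbTE ml) mulr0.
under [RHS]eq_bigr => l _ do under eq_bigr => m _ do rewrite -lew mulr_sumr.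
under [RHS]eq_bigr do rewrite exchange_big /=.
rewrite [RHS]exchange_big /=; apply: eq_bigr => k _.
rewrite /dotp mulr_suml mulr_sumr; apply: eq_bigr => l _.
rewrite !mulr_sumr; apply: eq_bigr => m _; ring.
Qed.

Lemma sum_enorm_lewis : \sum_k enorm (b k) = r%:R.
Proof.
transitivity (\sum_(i < r) ((i == i)%:R : R)); last first.
  by under eq_bigr do rewrite eqxx; rewrite sumr_const card_ord.
under [RHS]eq_bigr do rewrite -lew.
rewrite exchange_big /=; apply: eq_bigr => k _; rewrite -mulr_sumr.
under [X in _ * X]eq_bigr do rewrite -expr2.
rewrite -sqr_enorm; have [->|e0] := eqVneq (enorm (b k)) 0.
  by rewrite invr0 mul0r.
by field.
Qed.

(* Splitting [b k] into [copies k] equal pieces makes all pieces of length at most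
   [2 r / K] while creating at most [3 K / 2] of them. *)
Definition copies k : nat :=
  if b k == 0 then 0%N else (Num.trunc (enorm (b k) * K%:R / (2 * r%:R))).+1.

Definition copy := {k : I & 'I_(copies k)}.

Lemma sum_copy (F : I -> R) : \sum_(j : copy) F (tag j) = \sum_k (copies k)%:R * F k.
Proof.
have := @sig_big_dep R 0 +%R I (fun k => 'I_(copies k) : finType) xpredT
   (fun _ _ => true) (fun k _ => F k).
move=> /= <-; apply: eq_bigr => k _.
by rewrite sumr_const card_ord mulr_natl.
Qed.

(** The truncated quotients add up to at most K/2 because the lengths sum to r; the successor adds
    one piece per nonzero vector. *)
Lemma card_copy : #|{: copy}|%:R <= 3 / 2 * K%:R :> R.
Proof.
have -> : #|{: copy}|%:R = \sum_(j : copy) 1 :> R by rewrite sumr_const.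
rewrite (sum_copy (fun=> 1)).
have h k : (copies k)%:R * 1 <=
    enorm (b k) * (K%:R / (2 * r%:R)) + (if b k != 0 then 1 else 0) :> R.
  rewrite mulr1 /copies; case: eqP => [->|_] /=; first by rewrite enorm0 mul0r addr0.
  rewrite -addn1 natrD lerD2r mulrA; apply: (proj1 (andP (truncn_itv _))).
  by rewrite divr_ge0 // mulr_ge0 // enorm_ge0.
apply: le_trans (ler_sum _ (fun k _ => h k)) _.
rewrite big_split /= -mulr_suml sum_enorm_lewis -big_mkcond /= sumr_const.
have -> : r%:R * (K%:R / (2 * r%:R)) = K%:R / 2 :> R by field; rewrite gt_eqF.
have : (#|[pred k | b k != 0]|%:R <= K%:R :> R).
  by rewrite ler_nat; apply: leq_trans bK; rewrite cardsE.
by rewrite -[1 *+ _]/(_%:R); lra.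
Qed.

Lemma copies_bound k : enorm (b k) <= 2 * r%:R / K%:R * (copies k)%:R.
Proof.
rewrite /copies; case: eqP => [->|_]; first by rewrite enorm0 mulr0.
have := truncnS_gt (enorm (b k) * K%:R / (2 * r%:R)).
set T := _.+1%:R; rewrite ltr_pdivrMr ?mulr_gt0 // => h.
rewrite mulrAC ler_pdivlMr //; apply: le_trans (ltW h) _.
by rewrite mulrC.
Qed.

Lemma copies_eq0 k : copies k = 0%N -> b k = 0.
Proof. by rewrite /copies; case: eqP. Qed.

Definition piece (j : copy) : 'rV[R]_r := (copies (tag j))%:R^-1 *: b (tag j).

(** Component of a piece along the unit vector in the direction of [b i]. For fixed [i] these are
    the coefficients of one subgaussian variable. *)
Definition coef (i : I) (j : copy) : R := (enorm (b i))^-1 * dotp (piece j) (b i).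

(** A vector cut into c pieces contributes 1/c times its squared component, and [copies_bound] gives
    1/c <= v / |b_k|. What is left is the resolution of the identity at [b i]. *)
Lemma variance_coef i : \sum_j coef i j ^+ 2 <= 2 * r%:R / K%:R.
Proof.
pose F k := ((enorm (b i))^-1 * ((copies k)%:R^-1 * dotp (b k) (b i))) ^+ 2.
have -> : \sum_j coef i j ^+ 2 = \sum_(j : copy) F (tag j).
  by apply: eq_bigr => j _; rewrite /coef /piece dotpZl.
rewrite sum_copy; set v := 2 * r%:R / K%:R.
have v0 : 0 < v by rewrite divr_gt0 ?mulr_gt0.
have [bi0|bi0] := eqVneq (b i) 0.
  rewrite big1 => [|k _]; first exact: ltW.
  by rewrite /F bi0 enorm0 invr0 mul0r expr0n /= mulr0.
have ei : enorm (b i) != 0 by apply: contra_neq bi0 => /enorm_eq0.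
apply: (@le_trans _ _ (\sum_k v * (enorm (b i)) ^- 2 *
    ((enorm (b k))^-1 * (dotp (b i) (b k) * dotp (b k) (b i))))).
  apply: ler_sum => k _; rewrite /F [dotp (b i) (b k)]dotpC.
  have [bk0|bk0] := eqVneq (b k) 0.
    by rewrite bk0 dotp0l !mulr0 expr0n /= mulr0 lexx.
  have ek : 0 < enorm (b k).
    by rewrite lt_neqAle enorm_ge0 andbT eq_sym; apply: contra_neq bk0 => /enorm_eq0.
  have cp : 0 < (copies k)%:R :> R by rewrite ltr0n /copies (negbTE bk0).
  set D := dotp _ _.
  have -> : (copies k)%:R * ((enorm (b i))^-1 * ((copies k)%:R^-1 * D)) ^+ 2 =
     (enorm (b i)) ^- 2 * D ^+ 2 * (copies k)%:R^-1.
    by field; rewrite ei gt_eqF.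
  have -> : v * enorm (b i) ^- 2 * ((enorm (b k))^-1 * (D * D)) =
     (enorm (b i)) ^- 2 * D ^+ 2 * (v * (enorm (b k))^-1).
    by field; rewrite ei gt_eqF.
  apply: ler_wpM2l.
    by rewrite mulr_ge0 ?sqr_ge0 // invr_ge0 sqr_ge0.
  by rewrite ler_pdivlMr // mulrC ler_pdivrMr //; exact: copies_bound.
rewrite -mulr_sumr lewis_dotp.
have -> : dotp (b i) (b i) = enorm (b i) ^+ 2.
  by rewrite sqr_enorm; apply: eq_bigr => l _; rewrite expr2.
by rewrite -mulrA mulVf ?mulr1 // expf_neq0.
Qed.

Lemma sum_copy_abs z : \sum_j `|dotp (piece j) z| = \sum_k `|dotp (b k) z|.
Proof.
pose F k := `|(copies k)%:R^-1 * dotp (b k) z|.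
have -> : \sum_j `|dotp (piece j) z| = \sum_(j : copy) F (tag j).
  by apply: eq_bigr => j _; rewrite dotpZl.
rewrite sum_copy; apply: eq_bigr => k _; rewrite /F.
have [c0|c0] := eqVneq (copies k) 0%N.
  by rewrite (copies_eq0 c0) dotp0l mulr0 normr0 mulr0.
rewrite normrM ger0_norm ?invr_ge0 // mulrA divff ?mul1r //.
by rewrite pnatr_eq0.
Qed.

(** The supremum over z reduces to a finite maximum: by [lewis_dotp] the signed sum is a combination
    of the variables [\sum_j (-1) ^+ e j * coef k j] whose coefficients [dotp (b k) z] have absolute
    sum at most 1. *)
Lemma signed_sum_le (e : {ffun copy -> bool}) z (B : R) :
  (forall i, b i != 0 -> \sum_j (-1) ^+ e j * coef i j <= B) ->
  (forall i, b i != 0 -> - B <= \sum_j (-1) ^+ e j * coef i j) ->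
  \sum_k `|dotp (b k) z| <= 1 -> 0 <= B ->
  \sum_j (-1) ^+ e j * dotp (piece j) z <= B.
Proof.
move=> h1 h2 z1 B0.
pose g := \sum_j (-1) ^+ e j *: piece j.
have -> : \sum_j (-1) ^+ e j * dotp (piece j) z = dotp g z.
  by rewrite dotp_suml; apply: eq_bigr => j _; rewrite [in RHS]dotpZl.
rewrite -lewis_dotp; apply: (@le_trans _ _ (\sum_k B * `|dotp (b k) z|)); last first.
  by rewrite -mulr_sumr ler_piMr.
apply: ler_sum => k _.
have [bk0|bk0] := eqVneq (b k) 0; first by rewrite bk0 dotp0l !mulr0 normr0 mulr0.
apply: le_trans (ler_norm _) _; rewrite mulrA normrM ler_wpM2r //.
have -> : (enorm (b k))^-1 * dotp g (b k) = \sum_j (-1) ^+ e j * coef k j.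
  rewrite dotp_suml mulr_sumr; apply: eq_bigr => j _.
  by rewrite dotpZl /coef mulrCA.
by rewrite ler_norml h1 ?h2.
Qed.

Lemma sum_expR_coef i s (m : bool) :
  \sum_(e : {ffun copy -> bool}) expR ((-1) ^+ m * s * \sum_j (-1) ^+ e j * coef i j)
  <= 2 ^+ #|{: copy}| * expR (4 * s ^+ 2 * r%:R / K%:R).
Proof.
have := sum_expR_sign (fun j => (-1) ^+ m * s * coef i j).
set S := \sum_j _ ^+ 2; have -> : S = s ^+ 2 * \sum_j coef i j ^+ 2.
  rewrite mulr_sumr; apply: eq_bigr => j _.
  by rewrite !exprMn sqrr_sign mul1r.
move=> h; apply: le_trans (le_trans _ h) _.
  rewrite le_eqVlt; apply/orP; left; apply/eqP; apply: eq_bigr => e _.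
  by congr expR; rewrite mulr_sumr; apply: eq_bigr => j _; rewrite mulrCA.
rewrite ler_wpM2l ?exprn_ge0 // ler_expR.
have := variance_coef i; have := sqr_ge0 s => s0 hv.
have -> : 4 * s ^+ 2 * r%:R / K%:R = 2 * (s ^+ 2 * (2 * r%:R / K%:R)) :> R.
  by field; rewrite gt_eqF.
by rewrite ler_wpM2l // ler_wpM2l.
Qed.

Lemma lewis_signs d : 0 < d -> 16 * r%:R * (ln (2 * K%:R) + 1) <= d ^+ 2 * K%:R ->
  exists e : {ffun copy -> bool}, (#|[set j | ~~ e j]%SET| <= #|{: copy}|./2)%N /\
    forall z, \sum_k `|dotp (b k) z| <= 1 ->
      `|\sum_j (-1) ^+ e j * `|dotp (piece j) z| | <= 2 * d.
Proof.
move=> d0 hK; set L := ln (2 * K%:R) + 1 in hK.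
have K1 : 1 <= K%:R :> R by rewrite ler1n.
have lK : 0 <= ln (2 * K%:R) :> R by apply: ln_ge0; lra.
have L1 : 1 <= L by rewrite /L; lra.
(* For this [s] the hypothesis [hK] amounts to [v <= L], and the mean of [B] is at most
   [(c + 1) / s <= 2 * L / s = d]. *)
pose s := 2 * L / d; pose v := 2 * s ^+ 2 * (2 * r%:R / K%:R).
have s0 : 0 < s by rewrite divr_gt0 // mulr_gt0 //; lra.
have v0 : 0 <= v.
  apply: mulr_ge0; first by rewrite mulr_ge0 ?sqr_ge0.
  by rewrite ltW // divr_gt0 // mulr_gt0.
have vL : v <= L.
  have -> : v = 16 * r%:R * L * (L / (d ^+ 2 * K%:R)).
    by rewrite /v /s; field; rewrite !gt_eqF.
  apply: le_trans (ler_wpM2r _ hK) _.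
    by rewrite divr_ge0 ?mulr_ge0 ?sqr_ge0 //; lra.
  by rewrite mulrC divfK // mulf_neq0 ?gt_eqF // exprn_gt0.
(* Shifted by [c], each exponential has mean at most 1/(2K). Two signs and at most K nonzero vectors
   give a total of at most 1. *)
pose c := ln (2 * K%:R) + v.
pose X (e : {ffun copy -> bool}) i := \sum_j (-1) ^+ e j * coef i j.
pose B e := (c + \sum_(i | b i != 0)
   (expR (s * X e i - c) + expR (- (s * X e i) - c))) / s.
have c0 : 0 <= c by rewrite addr_ge0.
have Bsum0 e (p : pred I) :
    0 <= \sum_(i | p i) (expR (s * X e i - c) + expR (- (s * X e i) - c)).
  by apply: sumr_ge0 => i _; rewrite addr_ge0 ?expR_ge0.
(* A crude maximum bound: [x <= c + expR (x - c)]. *)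
have XB e i : b i != 0 -> X e i <= B e /\ - B e <= X e i.
  move=> bi.
  have h1 := expR_ge1Dx (s * X e i - c).
  have h2 := expR_ge1Dx (- (s * X e i) - c).
  have h3 := expR_ge0 (s * X e i - c).
  have h4 := expR_ge0 (- (s * X e i) - c).
  have h5 := Bsum0 e (fun j => (b j != 0) && (j != i)).
  rewrite /B (bigD1 i) //=; set S := \sum_(_ | _) _ in h5 *; split.
    by rewrite ler_pdivlMr // mulrC; lra.
  by rewrite lerNl ler_pdivlMr // mulNr mulrC; lra.
apply: (exists_balanced_sign (P := [set z | \sum_k `|dotp (b k) z| <= 1])
  (t := fun j z => dotp (piece j) z) (B := B)).
- move=> j; exists 1 => z /= hz; apply: le_trans hz; rewrite -sum_copy_abs.
  by rewrite (bigD1 j) //= lerDl sumr_ge0.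
- exists 0 => [/=|j]; last by rewrite dotpC dotp0l.
  by rewrite big1 // => k _; rewrite dotpC dotp0l normr0.
- move=> e z hz; apply: signed_sum_le => // [i bi|i bi|].
  + by have [] := XB e i bi.
  + by have [] := XB e i bi.
  + by rewrite divr_ge0 ?(ltW s0) // addr_ge0.
pose E2 : R := 2 ^+ #|{: copy}|.
have E20 : 0 < E2 by rewrite exprn_gt0.
have tail i : \sum_e (expR (s * X e i - c) + expR (- (s * X e i) - c))
    <= E2 * K%:R^-1.
  rewrite big_split /=.
  have h (m : bool) : \sum_e expR ((-1) ^+ m * s * X e i - c) <= E2 / (2 * K%:R).
    under eq_bigr do rewrite expRD; rewrite -mulr_suml.
    apply: le_trans (ler_wpM2r (expR_ge0 _) (sum_expR_coef i s m)) _.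
    rewrite -/E2 -[leLHS]mulrA ler_wpM2l ?(ltW E20) // -expRD opprD addrCA.
    have -> : 4 * s ^+ 2 * r%:R / K%:R - v = 0.
      by rewrite /v; field; rewrite gt_eqF.
    by rewrite addr0 expRN lnK // posrE mulr_gt0.
  have ha : \sum_e expR (s * X e i - c) <= E2 / (2 * K%:R).
    by apply: le_trans (h false); under [leRHS]eq_bigr do rewrite expr0 mul1r.
  have hb : \sum_e expR (- (s * X e i) - c) <= E2 / (2 * K%:R).
    by apply: le_trans (h true); under [leRHS]eq_bigr do rewrite expr1 mulN1r mulNr.
  apply: le_trans (lerD ha hb) _.
  by rewrite le_eqVlt; apply/orP; left; apply/eqP; field; rewrite gt_eqF.
rewrite /B -mulr_suml big_split /= exchange_big /= sumr_const.
have -> : c *+ #|{: {ffun copy -> bool}}| = E2 * c.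
  by rewrite card_ffun card_bool -mulr_natl natrX.
apply: (@le_trans _ _ ((E2 * c + E2) / s)).
  rewrite ler_pM2r ?invr_gt0 // lerD2l.
  apply: le_trans (ler_sum _ (fun i _ => tail i)) _.
  rewrite sumr_const -[leLHS]mulr_natr -mulrA ger_pMr // mulrC ler_pdivrMr // mul1r.
  by rewrite ler_nat; apply: leq_trans bK; rewrite cardsE.
rewrite -[X in _ + X]mulr1 -mulrDr -mulrA ler_pM2l // ler_pdivrMr // /s.
have -> : d * (2 * L / d) = 2 * L by field; rewrite gt_eqF.
by rewrite /c; move: vL; rewrite /L; lra.
Qed.

Lemma lewis_halving d : 0 < d -> 16 * r%:R * (ln (2 * K%:R) + 1) <= d ^+ 2 * K%:R ->
  exists t : I -> R, [/\ forall k, 0 <= t k,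
    (4 * #|[set k | t k != 0%R]%SET| <= 3 * K)%N &
    forall z, `|\sum_k t k * `|dotp (b k) z| - \sum_k `|dotp (b k) z| |
      <= 2 * d * \sum_k `|dotp (b k) z| ].
Proof.
move=> d0 hK; have [e [ce he]] := lewis_signs d0 hK.
(* Pieces with sign +1 count twice and the others vanish, so at most half of the 3K/2 pieces
   survive. *)
pose t k : R := \sum_(j : copy | tag j == k) (1 + (-1) ^+ e j) / (copies k)%:R.
have sgn0 j : 0 <= 1 + (-1) ^+ e j :> R.
  by case: (e j); rewrite ?expr1 ?expr0; lra.
exists t; split.
- by move=> k; apply: sumr_ge0 => j _; rewrite divr_ge0.
- have sub : ([set k | t k != 0%R] \subset
      (fun j : copy => tag j) @: [set j | ~~ e j])%SET.
    apply/fintype.subsetP => k; rewrite inE; apply: contraNT => hk.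
    apply/eqP; apply: big1 => j /eqP jk.
    have ej : e j.
      apply: contraR hk => ej; rewrite -jk; apply: imset_f.
      by rewrite inE.
    by rewrite ej expr1 subrr mul0r.
  have h1 := leq_trans (subset_leq_card sub) (leq_imset_card _ _).
  have h2 : (2 * #|{: copy}| <= 3 * K)%N.
    rewrite -(ler_nat R) !natrM; have := card_copy; lra.
  have := leq_trans h1 ce => h3.
  have := odd_double_half #|{: copy}|; rewrite -muln2; move: h2 h3.
  by case: (odd _) => /= *; lia.
move=> z.
have E y : \sum_k t k * `|dotp (b k) y| - \sum_k `|dotp (b k) y| =
    \sum_j (-1) ^+ e j * `|dotp (piece j) y|.
  have -> : \sum_k t k * `|dotp (b k) y| =
      \sum_j (1 + (-1) ^+ e j) * `|dotp (piece j) y|.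
    rewrite [RHS](partition_big (fun j : copy => tag j) xpredT) //=.
    apply: eq_bigr => k _; rewrite mulr_suml; apply: eq_bigr => j /eqP jk.
    rewrite /piece [in RHS]dotpZl normrM jk [X in _ = _ * (X * _)]ger0_norm ?invr_ge0 //.
    by rewrite mulrA.
  under eq_bigr do rewrite mulrDl mul1r.
  by rewrite big_split /= sum_copy_abs addrAC subrr add0r.
set S := \sum_k `|dotp (b k) z|.
have S0 : 0 <= S by apply: sumr_ge0.
(* The bound for [S <= 1] extends by homogeneity, which needs [S] nonzero. *)
have [Sz|Sz] := eqVneq S 0.
  rewrite Sz mulr0 subr0.
  suff h k : `|dotp (b k) z| = 0 by rewrite big1 ?normr0 // => k _; rewrite h mulr0.
  by move/eqP: Sz; rewrite psumr_eq0 // => /allP/(_ k); rewrite mem_index_enum => /(_ isT)/eqP.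
have Sp : 0 < S by rewrite lt_neqAle eq_sym Sz.
have sc (F : I -> R) : \sum_k F k * `|dotp (b k) (S^-1 *: z)| =
    S^-1 * \sum_k F k * `|dotp (b k) z|.
  rewrite mulr_sumr; apply: eq_bigr => k _.
  by rewrite dotpZr normrM gtr0_norm ?invr_gt0 // mulrCA.
have sc1 : \sum_k `|dotp (b k) (S^-1 *: z)| = S^-1 * S.
  rewrite mulr_sumr; apply: eq_bigr => k _.
  by rewrite dotpZr normrM gtr0_norm ?invr_gt0.
have := he (S^-1 *: z); rewrite -E sc sc1 mulVf // lexx => /(_ isT).
rewrite -{1}(mulVf Sz) -mulrBr normrM gtr0_norm ?invr_gt0 //.
by rewrite mulrC ler_pdivrMr.
Qed.

End LewisHalving.

(** * Repeated thinning down to order n log n points *)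

Section Sparsify.
Variables (R : realType) (I : finType) (n : nat) (a : I -> 'rV[R]_n).

(** Lewis position needs a spanning family. A rank factorisation therefore rewrites the vectors
    [t k *: a k] in coordinates of their span, whose dimension is at most n. *)
Lemma sparsify_step (t : I -> R) (K : nat) d : (forall k, 0 <= t k) ->
  (#|[set k | t k != 0%R]%SET| <= K)%N -> (0 < K)%N -> 0 < d ->
  16 * n%:R * (ln (2 * K%:R) + 1) <= d ^+ 2 * K%:R ->
  exists t' : I -> R, [/\ forall k, 0 <= t' k,
    (4 * #|[set k | t' k != 0%R]%SET| <= 3 * K)%N &
    forall z, `|\sum_k t' k * `|dotp (a k) z| - \sum_k t k * `|dotp (a k) z| |
      <= 2 * d * \sum_k t k * `|dotp (a k) z| ].
Proof.
move=> t0 tK K0 d0 hK.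
pose A : 'M[R]_(#|I|, n) := \matrix_i (t (enum_val i) *: a (enum_val i)).
pose r := \rank A.
pose c k : 'rV[R]_r := row (enum_rank k) (col_base A).
have cE k : t k *: a k = c k *m row_base A.
  by rewrite -row_mul mulmx_base rowK enum_rankK.
have abs_t k z : t k * `|dotp (a k) z| = `|dotp (t k *: a k) z|.
  by rewrite dotpZl normrM (ger0_norm (t0 k)).
have [r0|r0] := posnP r.
  exists (fun=> 0); split => // [|z].
    rewrite (_ : [set k | 0 != 0 :> R]%SET = finset.set0) ?cards0 //.
    by apply/setP => k; rewrite !inE eqxx.
  have h k : t k * `|dotp (a k) z| = 0.
    rewrite abs_t cE (_ : c k = 0) ?mul0mx ?dotp0l ?normr0 //.
    by apply/rowP => j; have := ltn_ord j; rewrite [X in (_ < X)%N]r0.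
  by rewrite big1 ?big1 ?subrr ?normr0 ?mulr0 // => k _; rewrite ?mul0r.
have span_c : exists l : 'I_r -> I -> R,
    forall i j, \sum_k l i k * c k 0 j = (i == j)%:R.
  have /row_fullP[Bm hB] := col_base_full A.
  exists (fun i k => Bm i (enum_rank k)) => i j.
  have := congr1 (fun M : 'M[R]_r => M i j) hB; rewrite !mxE => <-.
  rewrite [RHS](reindex (@enum_rank I)); last first.
    by apply: onW_bij; exact: enum_rank_bij.
  by apply: eq_bigr => k _; rewrite mxE.
have [T [Tu hT]] := lewis_position span_c r0.
pose b k := c k *m T.
have bK : (#|[set k | b k != 0%R]%SET| <= K)%N.
  apply: leq_trans tK; apply: subset_leq_card; apply/fintype.subsetP => k.
  rewrite !inE; apply: contra_neq => tk.
  have : c k *m row_base A = 0 by rewrite -cE tk scale0r.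
  move/eqP; rewrite mulmx_free_eq0 ?row_base_free // => /eqP ck.
  by rewrite /b ck mul0mx.
have [|t' [t'0 t'K ht']] := @lewis_halving R I r b K hT bK r0 K0 d d0 _.
  apply: le_trans hK; rewrite ler_wpM2r //.
    by rewrite addr_ge0 // ln_ge0 // -[1]/(1%:R) -natrM ler_nat muln_gt0.
  by rewrite ler_wpM2l // ler_nat rank_leq_col.
exists (fun k => t' k * t k); split.
- by move=> k; rewrite mulr_ge0.
- apply: leq_trans t'K; rewrite leq_mul2l /=; apply: subset_leq_card.
  apply/fintype.subsetP => k; rewrite !inE; apply: contra_neq => ->.
  by rewrite mul0r.
(* The dual change of coordinates: [dotp (b k) y] equals [dotp (t k *: a k) z]. *)
move=> z; pose y := z *m (row_base A)^T *m (invmx T)^T.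
have dE k : `|dotp (b k) y| = t k * `|dotp (a k) z|.
  rewrite abs_t cE dotp_mulmx /b dotp_mulmx /y -mulmxA -trmx_mul mulmxV //.
  by rewrite trmx1 mulmx1.
have := ht' y; under [\sum_k t' k * _]eq_bigr do rewrite dE mulrA.
by under [\sum_k `|_|]eq_bigr do rewrite dE.
Qed.

End Sparsify.

Lemma bernoulli_ge (R : realType) (x : R) j : 0 <= x -> 1 + j%:R * x <= (1 + x) ^+ j.
Proof.
move=> x0; elim: j => [|j IH]; first by rewrite mul0r addr0 expr0.
rewrite exprS -natr1.
have := ler_wpM2l (_ : 0 <= 1 + x) IH => /(_ ltac:(lra)).
have : 0 <= j%:R * x * x by rewrite !mulr_ge0.
by nra.
Qed.

Lemma half_le_ln2 (R : realType) : 1 / 2 <= ln 2 :> R.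
Proof.
rewrite -ler_expR lnK ?posrE //.
have h := expR_ge1Dx (- (1 / 2)) : 1 + - (1 / 2) <= expR (- (1 / 2) : R).
have p : 0 < expR (1 / 2 : R) by exact: expR_gt0.
have e : expR (- (1 / 2) : R) * expR (1 / 2) = 1 by rewrite -expRD addNr expR0.
by nra.
Qed.

Lemma ln_leB1 (R : realType) (x : R) : 0 < x -> ln x <= x - 1.
Proof.
by move=> x0; have := expR_ge1Dx (ln x); rewrite lnK ?posrE //; lra.
Qed.

Section Iterate.
Variables (R : realType) (C : R) (n : nat).
Hypothesis n1 : (1 < n)%N.
Hypotheses (hC : 576 * (5 * (160 * 160)) <= C) (lnC : ln (2 * C) <= 31 * ln 2).

(** Chosen with [q ^+ 2 * (4 / 3) >= 6 / 5]: the squared error allowance times the number of points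
    still grows geometrically in the level, against a linear growth of the logarithm. *)
Let q : R := 19 / 20.
Let m0 : R := C * n%:R * ln n%:R.

Let ln_n : 1 / 2 <= ln n%:R :> R.
Proof.
apply: le_trans (half_le_ln2 R) _.
by rewrite ler_ln ?posrE ?ltr0n ?ler_nat // (ltn_trans _ n1).
Qed.

Let n2 : 2 <= n%:R :> R. Proof. by rewrite ler_nat. Qed.

Let nln : 1 <= n%:R * ln n%:R :> R.
Proof. by have := ln_n; have := n2; nra. Qed.

Let C1 : 1 <= C.
Proof. by apply: le_trans hC; rewrite -!natrM ler1n. Qed.

Let C0 : 0 < C. Proof. exact: lt_le_trans C1. Qed.

Lemma m0_ge1 : 1 <= C * n%:R * ln n%:R.
Proof.
by rewrite -mulrA; apply: le_trans nln _; rewrite ler_peMl ?C1 // (le_trans _ nln).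
Qed.

(* At level j there remain about [m0 (4/3)^j] points, and a relative error of
   order [q^j] is allowed. *)
Lemma step_condition (K : nat) j : m0 * (4 / 3) ^+ j < K%:R ->
  K%:R <= m0 * (4 / 3) ^+ j.+1 ->
  16 * n%:R * (ln (2 * K%:R) + 1) <= (q ^+ j / 160) ^+ 2 * K%:R.
Proof.
move=> Kl Ku; have m01' : 1 <= m0 := m0_ge1; have ln_n' := ln_n; have nln' := nln; have n2' := n2.
have p0 i : 0 < (4 / 3) ^+ i :> R by apply: exprn_gt0; lra.
have m0p : 0 < m0 by lra.
have K0 : 0 < K%:R :> R by apply: lt_trans Kl; rewrite mulr_gt0.
have lnp : 0 < ln n%:R :> R by lra.
have l1 : ln (2 * K%:R) <= ln (2 * C) + ln n%:R + ln (ln n%:R) + j.+1%:R * ln (4 / 3).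
  rewrite [j.+1%:R * _]mulr_natl -lnXn ?divr_gt0 // -!lnM ?posrE ?mulr_gt0 //; try lra.
  rewrite ler_ln ?posrE ?mulr_gt0 //; try lra.
  by move: Ku; rewrite /m0; lra.
have l2 : ln (2 * C) <= 31 * ln n%:R.
  apply: le_trans lnC _; apply: ler_wpM2l => //.
  by rewrite ler_ln ?posrE //; lra.
have l3 := ln_leB1 lnp.
have l4 : ln (4 / 3) <= 1 / 3 :> R.
  by apply: le_trans (ln_leB1 _) _; lra.
have j0 : 0 <= j%:R :> R by [].
(* The factors [C], [n] and [ln n] of [m0] account for 31 + 1 + 1 multiples of [ln n]; the powers of
   4/3 fit into the rest because [ln n] is at least 1/2. *)
have l5 : ln (2 * K%:R) + 1 <= 36 * (1 + j%:R) * ln n%:R :> R.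
  have a1 : j.+1%:R * ln (4 / 3) <= j.+1%:R * (1 / 3) :> R.
    by apply: ler_wpM2l l4.
  have a2 : j%:R * (1 / 2) <= j%:R * ln n%:R :> R by apply: ler_wpM2l.
  have a3 : j.+1%:R = j%:R + 1 :> R by rewrite natr1.
  by move: l1 a1; rewrite a3; lra.
have l6 : (1 + j%:R) / 5 <= (q ^+ j) ^+ 2 * (4 / 3) ^+ j.
  apply: (@le_trans _ _ ((1 + 1 / 5) ^+ j)).
    by apply: le_trans (bernoulli_ge _ _); lra.
  rewrite exprAC -exprMn lerXn2r ?nnegrE //; rewrite /q; try lra.
apply: (@le_trans _ _ ((q ^+ j / 160) ^+ 2 * (m0 * (4 / 3) ^+ j))); last first.
  by apply: ler_wpM2l (ltW Kl); exact: sqr_ge0.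
have -> : (q ^+ j / 160) ^+ 2 * (m0 * (4 / 3) ^+ j) =
   (q ^+ j) ^+ 2 * (4 / 3) ^+ j * (C / (160 * 160)) * (n%:R * ln n%:R).
  by rewrite /m0; field.
apply: (@le_trans _ _ ((1 + j%:R) / 5 * (C / (160 * 160)) * (n%:R * ln n%:R))); last first.
  rewrite ler_pM2r; last exact: lt_le_trans nln.
  by rewrite ler_pM2r // divr_gt0 // mulr_gt0.
apply: (@le_trans _ _ (16 * n%:R * (36 * (1 + j%:R) * ln n%:R))).
  by rewrite ler_wpM2l //; lra.
have -> : 16 * n%:R * (36 * (1 + j%:R) * ln n%:R) =
  576 * (1 + j%:R) * (n%:R * ln n%:R) :> R by ring.
rewrite ler_pM2r; last by lra.
have -> : (1 + j%:R) / 5 * (C / (160 * 160)) = (1 + j%:R) * (C / (5 * (160 * 160))).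
  by field.
rewrite mulrC ler_pM2l; last by lra.
by rewrite ler_pdivlMr //; lra.
Qed.

Variables (I : finType) (a : I -> 'rV[R]_n).

Let wsum (t : I -> R) z := \sum_k t k * `|dotp (a k) z|.

(** A halving at level j costs q^j / 80, while the allowance grows by q^j / 40. The difference pays
    for the factor [1 + q ^+ j / 80] by which [wsum t1] may exceed [wsum t]. *)
Lemma sparsify_levels j (t : I -> R) : (forall k, 0 <= t k) ->
  #|[set k | t k != 0%R]%SET|%:R <= m0 * (4 / 3) ^+ j ->
  exists t' : I -> R, [/\ forall k, 0 <= t' k,
    #|[set k | t' k != 0%R]%SET|%:R <= m0 &
    forall z, `|wsum t' z - wsum t z| <= (1 - q ^+ j) / 2 * wsum t z].
Proof.
elim: j t => [|j IH] t t0 tK.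
  exists t; split => // [|z]; first by move: tK; rewrite expr0 mulr1.
  by rewrite subrr normr0 expr0 subrr !mul0r.
have w0 (s : I -> R) z : (forall k, 0 <= s k) -> 0 <= wsum s z.
  by move=> s0; apply: sumr_ge0 => k _; rewrite mulr_ge0.
have q0 : 0 <= q ^+ j by rewrite exprn_ge0 // /q; lra.
have q1 : q ^+ j <= 1 by rewrite exprn_ile1 // /q; lra.
have [le|gt] := leP (#|[set k | t k != 0%R]%SET|%:R) (m0 * (4 / 3) ^+ j).
  have [t' [t'0 t'K ht']] := IH t t0 le.
  exists t'; split => // z; apply: le_trans (ht' z) _.
  have h : q ^+ j.+1 <= q ^+ j by rewrite exprS ler_piMl // /q; lra.
  by rewrite ler_wpM2r ?w0 //; lra.
have K0 : (0 < #|[set k | t k != 0%R]%SET|)%N.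
  rewrite -(ltr0n R); apply: lt_trans gt; apply: mulr_gt0.
    exact: lt_le_trans m0_ge1.
  by apply: exprn_gt0; lra.
have qp : 0 < q ^+ j / 160 by rewrite divr_gt0 // exprn_gt0 // /q; lra.
have [t1 [t10 t1K ht1]] := sparsify_step a t0 (leqnn _) K0 qp (step_condition gt tK).
have [|t' [t'0 t'K ht']] := IH t1 t10.
  move: t1K; rewrite -(ler_nat R) !natrM => h.
  move: tK; rewrite exprS; lra.
exists t'; split => // z.
have := ht' z; have := ht1 z; rewrite -/(wsum t1 z) -/(wsum t z).
move=> e1 e2; have wt := w0 t z t0; have wt1 := w0 t1 z t10.
have -> : wsum t' z - wsum t z = (wsum t' z - wsum t1 z) + (wsum t1 z - wsum t z).
  by ring.
apply: le_trans (ler_normD _ _) _; apply: le_trans (lerD e2 e1) _.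
have u1 : wsum t1 z <= (1 + q ^+ j / 80) * wsum t z.
  by move: e1; rewrite ler_norml => /andP[_]; lra.
have u2 : (1 - q ^+ j) / 2 * wsum t1 z <=
    (1 - q ^+ j) / 2 * ((1 + q ^+ j / 80) * wsum t z).
  by rewrite ler_wpM2l //; lra.
have u3 : 0 <= q ^+ j * q ^+ j * wsum t z by rewrite !mulr_ge0.
have u4 : 0 <= q ^+ j * wsum t z by rewrite mulr_ge0.
have -> : (1 - q ^+ j.+1) / 2 = (1 - q ^+ j) / 2 + q ^+ j / 40.
  by rewrite exprS /q; field.
by lra.
Qed.

End Iterate.

Lemma sparsify (R : realType) : exists2 C : R, 0 < C &
  forall (n : nat) (I : finType) (a : I -> 'rV[R]_n) (t : I -> R), (1 < n)%N ->
  (forall k, 0 <= t k) ->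
  exists t' : I -> R, [/\ forall k, 0 <= t' k,
    #|[set k | t' k != 0%R]%SET|%:R <= C * n%:R * ln n%:R &
    forall z, `|\sum_k t' k * `|dotp (a k) z| - \sum_k t k * `|dotp (a k) z| |
      <= 1 / 2 * \sum_k t k * `|dotp (a k) z|].
Proof.
(* The constant is 2^30. It has to exceed the factors met in [step_condition]: 576 = 16 * 36 from
   the logarithm, 5 from Bernoulli's inequality and 160^2 from the squared error. *)
have lnC : ln (2 * 2 ^+ 30) <= 31 * ln 2 :> R.
  by rewrite -exprS lnXn // mulr_natl.
have hC : 576 * (5 * (160 * 160)) <= 2 ^+ 30 :> R.
  have -> : 2 ^+ 30 = 2 ^+ 10 * (2 ^+ 4 * (2 ^+ 8 * 2 ^+ 8)) :> R by rewrite -!exprD.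
  have e1 : 576 <= 2 ^+ 10 :> R by rewrite -natrX ler_nat.
  have e2 : 5 <= 2 ^+ 4 :> R by rewrite -natrX ler_nat.
  have e3 : 160 <= 2 ^+ 8 :> R by rewrite -natrX ler_nat.
  have p k : 0 <= k%:R :> R by exact: ler0n.
  apply: (ler_pM (p _) (mulr_ge0 (p _) (mulr_ge0 (p _) (p _))) e1).
  apply: (ler_pM (p _) (mulr_ge0 (p _) (p _)) e2).
  exact: (ler_pM (p _) (p _) e3 e3).
move: hC lnC; have : 0 < 2 ^+ 30 :> R by rewrite exprn_gt0.
move: (2 ^+ 30 : R) => C C0 hC lnC; exists C => // n I a t n1 t0.
set K := #|[set k | t k != 0%R]%SET|.
(* By Bernoulli (4/3)^(3K) is at least K, so level 3K accommodates any start of K points. *)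
have [|t' [h1 h2 h3]] := sparsify_levels n1 hC lnC a (j := 3 * K) t0.
  have h : K%:R <= (4 / 3) ^+ (3 * K) :> R.
    have -> : 4 / 3 = 1 + 1 / 3 :> R by field.
    apply: le_trans (bernoulli_ge _ _); last lra.
    by rewrite natrM; lra.
  rewrite -[leLHS]mul1r; apply: ler_pM => //; exact: m0_ge1.
exists t'; split => // z; apply: le_trans (h3 z) _.
rewrite ler_wpM2r //; first by apply: sumr_ge0 => k _; rewrite mulr_ge0.
have : 0 <= (19 / 20) ^+ (3 * K) :> R by rewrite exprn_ge0 //; lra.
by lra.
Qed.

(** * Quadrature for finitely many integrable functions *)

Lemma fine_sum (R : realType) (I : finType) (f : I -> \bar R) :
  (forall i, f i \is a fin_num) -> fine (\sum_i f i)%E = \sum_i fine (f i).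
Proof.
move=> hf; have -> : (\sum_i f i = \sum_i (fine (f i))%:E)%E.
  by apply: eq_bigr => i _; rewrite fineK.
by rewrite sumEFin.
Qed.

Section Discretize.
Context d (T : measurableType d) (R : realType) (mu : probability T R).

Lemma integrable_lin (A : set T) (J : finType) (w : J -> R) (f : J -> T -> R) :
  measurable A -> (forall j, mu.-integrable A (EFin \o f j)) ->
  mu.-integrable A (EFin \o (fun x => \sum_j w j * f j x)).
Proof.
move=> mA hf; rewrite (_ : _ \o _ =
    (fun x => \sum_(j <- index_enum J | true) (w j)%:E * (EFin \o f j) x)%E).
  by apply: integrable_sum => // j _; exact: integrableZl.
by apply/funext => x /=; rewrite sumEFin.
Qed.

Lemma fin_num_mu (A : set T) : measurable A -> (mu A \is a fin_num)%E.
Proof.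
by move=> mA; rewrite ge0_fin_numE // (le_lt_trans (probability_le1 mu mA)) // ltry.
Qed.

Lemma integrable_cstR (A : set T) (c : R) : measurable A ->
  mu.-integrable A (EFin \o cst c).
Proof.
by move=> mA; exact: finite_measure_integrable_cst.
Qed.

Lemma integrable_dev (A : set T) n (y : 'I_n -> T -> R) (c : 'I_n -> R) :
  measurable A -> (forall j, mu.-integrable A (EFin \o y j)) ->
  mu.-integrable A (EFin \o (fun x => \sum_j `|y j x - c j|)).
Proof.
move=> mA hy.
have := @integrable_lin A 'I_n (fun=> 1) (fun j x => `|y j x - c j|) mA.
under eq_fun do under eq_bigr do rewrite mul1r.
apply => j; apply: (integrable_norm (f := fun x => y j x - c j)).
have := integrableB mA (hy j) (integrable_cstR (c j) mA).
by congr (_.-integrable _ _).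
Qed.

(** The node is a point where [h] exceeds its mean over [A] by at most [e]. The factor 2 counts [h]
    once under the integral and once at the node. *)
Lemma cell_quadrature (A : set T) n (y : 'I_n -> T -> R) (c : 'I_n -> R) (e : R) :
  measurable A -> 0 < fine (mu A) -> 0 < e ->
  (forall j, mu.-integrable A (EFin \o y j)) ->
  exists2 xi, A xi & forall z : 'rV[R]_n,
    `| \int[mu]_(x in A) `|\sum_j z 0 j * y j x|
       - fine (mu A) * `|\sum_j z 0 j * y j xi| |
    <= (\sum_j `|z 0 j|) *
       (2 * \int[mu]_(x in A) (\sum_j `|y j x - c j|) + e * fine (mu A)).
Proof.
move=> mA mu0 e0 hy.
pose h x := \sum_j `|y j x - c j|; pose I0 := \int[mu]_(x in A) h x.
have ih : mu.-integrable A (EFin \o h) by exact: integrable_dev.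
have [xi Axi hxi] : exists2 xi, A xi & fine (mu A) * h xi <= I0 + e * fine (mu A).
  apply: contrapT => hN.
  have gt x : A x -> I0 / fine (mu A) + e <= h x.
    move=> Ax; rewrite leNgt; apply/negP => lt; apply: hN; exists x => //.
    have -> : I0 + e * fine (mu A) = fine (mu A) * (I0 / fine (mu A) + e).
      by field; rewrite gt_eqF.
    by rewrite ler_pM2l // ltW.
  have := le_Rintegral mA (integrable_cstR _ mA) ih gt.
  rewrite Rintegral_cst // -/I0 mulrDl divfK ?gt_eqF //.
  by have := mulr_gt0 e0 mu0; lra.
exists xi => // z.
pose g x := \sum_j z 0 j * y j x.
have ig : mu.-integrable A (EFin \o (fun x => `|g x|)).
  by apply: integrable_norm => //; exact: integrable_lin.
have -> : fine (mu A) * `|\sum_j z 0 j * y j xi| = \int[mu]_(x in A) `|g xi|.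
  by rewrite Rintegral_cst // mulrC.
rewrite -RintegralB //; last exact: integrable_cstR.
have id : mu.-integrable A (EFin \o (fun x => `|g x| - `|g xi|)).
  have := integrableB mA ig (integrable_cstR `|g xi| mA).
  by congr (_.-integrable _ _).
apply: le_trans (le_normr_Rintegral mA id) _.
pose Z := \sum_j `|z 0 j|.
have ihc : mu.-integrable A (EFin \o (fun x => h x + h xi)).
  have := integrableD mA ih (integrable_cstR (h xi) mA).
  by congr (_.-integrable _ _).
have ihZ : mu.-integrable A (EFin \o (fun x => Z * (h x + h xi))).
  have := integrableZl mA Z ihc.
  by congr (_.-integrable _ _).
have Z0 : 0 <= Z by apply: sumr_ge0.
apply: (@le_trans _ _ (\int[mu]_(x in A) (Z * (h x + h xi)))).
  apply: le_Rintegral => //; first exact: (integrable_norm id).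
  move=> x Ax; apply: le_trans (ler_dist_dist _ _) _.
  rewrite /g -sumrB; apply: le_trans (ler_norm_sum _ _ _) _.
  rewrite mulr_suml; apply: ler_sum => j _.
  rewrite -mulrBr normrM ler_wpM2l //.
  have hj x' : `|y j x' - c j| <= h x'.
    by rewrite /h (bigD1 j) //= lerDl sumr_ge0.
  have -> : y j x - y j xi = (y j x - c j) - (y j xi - c j) by ring.
  by apply: le_trans (ler_normB _ _) _; rewrite lerD.
rewrite RintegralZl // ler_wpM2l // RintegralD //; last exact: integrable_cstR.
by rewrite Rintegral_cst // -/I0; move: hxi; rewrite mulrC; lra.
Qed.

(** A null cell may be empty; its weight is 0, so any point of [D] can be its node. *)
Lemma cell_quadrature0 (D A : set T) n (y : 'I_n -> T -> R) (c : 'I_n -> R) (e : R) :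
  measurable D -> measurable A -> A `<=` D -> D !=set0 -> 0 < e ->
  (forall j, mu.-integrable D (EFin \o y j)) ->
  exists2 xi, D xi & forall z : 'rV[R]_n,
    `| \int[mu]_(x in A) `|\sum_j z 0 j * y j x|
       - fine (mu A) * `|\sum_j z 0 j * y j xi| |
    <= (\sum_j `|z 0 j|) *
       (2 * \int[mu]_(x in A) (\sum_j `|y j x - c j|) + e * fine (mu A)).
Proof.
move=> mD mA AD [x0 Dx0] e0 hyD.
have hy j : mu.-integrable A (EFin \o y j) by exact: integrableS (hyD j).
have : 0 <= fine (mu A) by rewrite fine_ge0.
rewrite le_eqVlt => /orP[/eqP mu0|mup]; last first.
  by have [xi Axi hxi] := cell_quadrature c mA mup e0 hy; exists xi => //; exact: AD.
exists x0 => // z; rewrite -mu0 mul0r mulr0 addr0 subr0.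
have muA : mu A = 0%E by rewrite -[LHS]fineK ?fin_num_mu // -mu0.
rewrite [X in `|X|](_ : _ = 0); last first.
  rewrite /Rintegral null_set_integral //.
  have ig : mu.-integrable A (EFin \o (fun x => `|\sum_j z 0 j * y j x|)).
    by apply: (integrable_norm (f := fun x => \sum_j z 0 j * y j x)); exact: integrable_lin.
  exact: (measurable_int mu ig).
rewrite normr0 mulr_ge0 ?sumr_ge0 // mulr_ge0 // Rintegral_ge0 // => x _.
exact: sumr_ge0.
Qed.

Lemma sfun_dense_L1 (D : set T) (f : T -> R) (e : R) : measurable D -> 0 < e ->
  mu.-integrable D (EFin \o f) ->
  exists s : T -> R, [/\ measurable_fun setT s, finite_set (range s),
    mu.-integrable D (EFin \o s) & \int[mu]_(x in D) `|f x - s x| <= e].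
Proof.
move=> mD e0 hf.
have [g [ig _ hg]] := approximation_sfun_integrable mD hf.
have /fine_cvgP[_ /cvgrPdist_le/(_ e e0)[N _ /(_ N (leqnn N))]] := hg.
rewrite /= sub0r normrN => h; exists (g N); split.
- exact: measurable_funPT.
- exact: fimfunP.
- exact: ig.
by apply: le_trans (ler_norm _) _.
Qed.

Lemma exists_quadrature (D : set T) n (y : 'I_n -> T -> R) (eps : R) :
  measurable D -> D !=set0 -> 0 < eps ->
  (forall j, mu.-integrable D (EFin \o y j)) ->
  exists (I : finType) (xi : I -> T) (lam : I -> R),
    [/\ forall k, D (xi k), forall k, 0 <= lam k & forall z : 'rV[R]_n,
    `| \int[mu]_(x in D) `|\sum_j z 0 j * y j x|
       - \sum_k lam k * `|\sum_j z 0 j * y j (xi k)| |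
    <= eps * (\sum_j `|z 0 j|)].
Proof.
move=> mD D0 eps0 hy.
(* Then [2 * n * e1 <= eps / 2], and the choice of the nodes takes the other half; [n.+1] covers n =
   0. *)
pose e1 := eps / (4 * n.+1%:R).
have n0 : 0 < n.+1%:R :> R by rewrite ltr0n.
have e10 : 0 < e1 by rewrite divr_gt0 // mulr_gt0.
have /choice[s hs] : forall j, exists s : T -> R,
    [/\ measurable_fun setT s, finite_set (range s),
     mu.-integrable D (EFin \o s) & \int[mu]_(x in D) `|y j x - s x| <= e1].
  by move=> j; exact: (sfun_dense_L1 mD e10 (hy j)).
have /choice[v hv] : forall j, exists v : seq R, range (s j) = [set` v].
  by move=> j; have [_ /finite_seqP fs _ _] := hs j.
pose vals : seq R := flatten [seq v j | j : 'I_n].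
have svals j x : s j x \in vals.
  apply/flattenP; exists (v j); first by apply/mapP; exists j; rewrite ?mem_enum.
  have : range (s j) (s j x) by exists x.
  by rewrite hv.
(* Cells are the joint level sets of the simple functions [s j], indexed by tuples of values; some
   may be empty. *)
pose I : finType := {ffun 'I_n -> seq_sub vals}.
pose cell (c : I) := D `&` \bigcap_(j in [set: 'I_n]) (s j @^-1` [set val (c j)]).
have mcell c : measurable (cell c).
  apply: measurableI => //; apply: fin_bigcap_measurable; first exact: finite_finset.
  move=> j _; have [ms _ _ _] := hs j.
  by rewrite -[X in measurable X]setTI; exact: ms.
have cellD c : cell c `<=` D by move=> x [].
have triv : trivIset [set` index_enum I] cell.
  apply/trivIsetP => c c' _ _ /eqP cc'; rewrite -subset0 => x [[_ h1] [_ h2]].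
  apply: cc'; apply/ffunP => j; apply: val_inj.
  by rewrite -(h1 j Logic.I) -(h2 j Logic.I).
have cover : D = \big[setU/set0]_(c <- index_enum I) cell c.
  rewrite -bigcup_seq; apply/seteqP; split => x.
    move=> Dx; exists [ffun j => SeqSub (svals j x)].
      by rewrite /= mem_index_enum.
    by split => // j _; rewrite /= ffunE.
  by move=> [c _ []].
have split_int (f : T -> R) : mu.-integrable D (EFin \o f) ->
    \int[mu]_(x in D) f x = \sum_c \int[mu]_(x in cell c) f x.
  move=> hf; rewrite /Rintegral {1}cover integral_bigsetU_EFin //.
  - rewrite fine_sum // => c; apply: integrable_fin_num => //.
    exact: integrableS hf.
  - exact: index_enum_uniq.
  - by rewrite -cover; exact: (measurable_int mu hf).
have e20 : 0 < eps / 2 by rewrite divr_gt0.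
have /choice[xi hxi] : forall c : I, exists xi, D xi /\ forall z : 'rV[R]_n,
    `| \int[mu]_(x in cell c) `|\sum_j z 0 j * y j x|
       - fine (mu (cell c)) * `|\sum_j z 0 j * y j xi| |
    <= (\sum_j `|z 0 j|) * (2 * \int[mu]_(x in cell c) (\sum_j `|y j x - val (c j)|)
         + eps / 2 * fine (mu (cell c))).
  move=> c; have [xi] := cell_quadrature0 (fun j => val (c j)) mD (mcell c)
    (@cellD c) D0 e20 hy.
  by exists xi.
exists I, xi, (fun c => fine (mu (cell c))); split.
- by move=> c; have [] := hxi c.
- by move=> c; rewrite fine_ge0.
move=> z; pose Z := \sum_j `|z 0 j|.
rewrite split_int; last first.
  by apply: (integrable_norm (f := fun x => \sum_j z 0 j * y j x)); exact: integrable_lin.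
rewrite -sumrB; apply: le_trans (ler_norm_sum _ _ _) _.
apply: le_trans (ler_sum _ (fun c _ => (hxi c).2 z)) _.
rewrite -mulr_sumr mulrC ler_wpM2r ?sumr_ge0 // big_split /= -!mulr_sumr.
have -> : \sum_c \int[mu]_(x in cell c) (\sum_j `|y j x - val (c j)|) =
    \int[mu]_(x in D) (\sum_j `|y j x - s j x|).
  rewrite split_int.
    apply: eq_bigr => c _; apply: eq_Rintegral => x; rewrite inE => -[_ h].
    by apply: eq_bigr => j _; rewrite (h j Logic.I).
  have := @integrable_lin D 'I_n (fun=> 1) (fun j x => `|y j x - s j x|) mD.
  under eq_fun do under eq_bigr do rewrite mul1r.
  apply => j; apply: (integrable_norm (f := fun x => y j x - s j x)).
  have := integrableB mD (hy j) (let: And4 _ _ h _ := hs j in h).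
  by congr (_.-integrable _ _).
have -> : \sum_c fine (mu (cell c)) = fine (mu D).
  have := split_int (cst 1) (integrable_cstR 1 mD).
  rewrite Rintegral_cst // mul1r => ->.
  by apply: eq_bigr => c _; rewrite Rintegral_cst // mul1r.
have muD : fine (mu D) <= 1.
  by rewrite -[1]/(fine 1%E) fine_le ?fin_num_mu // probability_le1.
have hI : \int[mu]_(x in D) (\sum_j `|y j x - s j x|) <= n%:R * e1.
  have ij j : mu.-integrable D (EFin \o (fun x => `|y j x - s j x|)).
    apply: (integrable_norm (f := fun x => y j x - s j x)).
    have := integrableB mD (hy j) (let: And4 _ _ h _ := hs j in h).
    by congr (_.-integrable _ _).
  have -> : \int[mu]_(x in D) (\sum_j `|y j x - s j x|) =
      \sum_j \int[mu]_(x in D) `|y j x - s j x|.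
    rewrite /Rintegral; under eq_integral do rewrite -sumEFin.
    rewrite integral_sum // fine_sum // => j.
    by apply: integrable_fin_num => //; exact: ij.
  apply: (@le_trans _ _ (\sum_(j < n) e1)).
    by apply: ler_sum => j _; have [] := hs j.
  by rewrite sumr_const card_ord -[leLHS]mulr_natl.
have hn : n%:R * e1 <= eps / 4.
  have -> : eps / 4 = n.+1%:R * e1.
    by rewrite /e1; field; rewrite gt_eqF.
  by rewrite ler_pM2r // ler_nat.
have := ler_wpM2l (ltW e20) muD; rewrite mulr1; lra.
Qed.

End Discretize.

(** * Continuous functions on compact subsets of R^d *)

Section BorelRdFacts.
Variables (R : realType) (d : nat).
Implicit Types A : set 'rV[R]_d.

Lemma closed_measurable_Rd A : closed A -> measurable (A : set (BorelRd R d)).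
Proof.
move=> cA; rewrite -[A]setCK; apply: measurableC.
by apply: sub_sigma_algebra; exact: closed_openC.
Qed.

Lemma measurable_fun_within A (f : 'rV[R]_d -> R) :
  closed A -> {within A, continuous f} ->
  measurable_fun (A : set (BorelRd R d)) (f : BorelRd R d -> R).
Proof.
move=> cA /continuousP cf; apply: (measurability _ (measurable_realfun.RGenOpens.measurableE R)).
move=> _ [_ [a [b ->] <-]].
have oab : open (`]a, b[%classic : set R) by exact: interval_open.
have [V oV hV] := (open_subspaceP _ _).1 (cf _ oab).
rewrite setIC -hV; apply: measurableI; last exact: closed_measurable_Rd.
exact: sub_sigma_algebra.
Qed.

Lemma exists_max_within A (f : 'rV[R]_d -> R) : A !=set0 -> compact A ->
  {within A, continuous f} ->
  exists2 x, A x & forall y, A y -> `|f y| <= `|f x|.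
Proof.
move=> A0 cA cf.
have cn : {within A, continuous (fun x => `|f x|)}.
  by move=> x; exact: (continuous_comp (cf x) (@norm_continuous _ R _)).
have [x xA hx] := compact_EVT_max A0 cA cn.
exists x; first by move: xA; rewrite inE.
by move=> y Ay; apply: hx; rewrite inE.
Qed.

Lemma uniform_bound_within A (J : finType) (f : J -> 'rV[R]_d -> R) :
  A !=set0 -> compact A -> (forall j, {within A, continuous (f j)}) ->
  exists2 B, 0 <= B & forall j x, A x -> `|f j x| <= B.
Proof.
move=> A0 cA cf.
have /choice[B hB] : forall j, exists B, forall x, A x -> `|f j x| <= B.
  by move=> j; have [x _ hx] := exists_max_within A0 cA (cf j); exists `|f j x|.
exists (\sum_j `|B j|); first exact: sumr_ge0.
move=> j x Ax; apply: le_trans (hB j x Ax) _; apply: le_trans (ler_norm _) _.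
by rewrite (bigD1 j) //= lerDl sumr_ge0.
Qed.

Lemma within_spanf A N (u : 'I_N -> 'rV[R]_d -> R) c :
  (forall j, {within A, continuous (u j)}) -> {within A, continuous (spanf u c)}.
Proof.
move=> cu; apply: (@continuous_sumR R (subspace A)) => j.
by apply: continuous_mulR; [exact: cst_continuous|exact: cu].
Qed.

End BorelRdFacts.

(** * Recovery from samples with a reproducing kernel *)

Lemma sum_mxvec (R : realType) (m n : nat) (A B : 'M[R]_(m, n)) :
  \sum_l (mxvec A) 0 l * (mxvec B) 0 l = \sum_i \sum_j A i j * B i j.
Proof.
rewrite pair_bigA /=.
rewrite (reindex _ (curry_mxvec_bij _ _)) /=; apply: eq_bigr => -[i j] _ /=.
by rewrite !mxvecE.
Qed.

Section Recovery.
Variables (R : realType) (d : nat) (Omega : set 'rV[R]_d).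
Variables (mu : probability (BorelRd R d) R) (N : nat) (u : 'I_N -> 'rV[R]_d -> R).
Hypothesis cO : compact Omega.
Hypothesis muO : mu Omega = 1%E.
Hypothesis cu : forall j, {within Omega, continuous (u j)}.
Hypothesis orth : forall i j,
  (\int[mu]_(y in Omega) (u i y * u j y)%:E)%E = ((i == j)%:R)%:E.
Hypothesis one_span : exists c, forall x, Omega x -> spanf u c x = 1.

Let clO : closed Omega.
Proof. by apply: compact_closed => //; exact: norm_hausdorff. Qed.

Let mO : measurable (Omega : set (BorelRd R d)).
Proof. exact: closed_measurable_Rd. Qed.

Lemma Omega_neq0 : Omega !=set0.
Proof.
apply/set0P/eqP => O0; move: muO; rewrite O0 measure0 => /eqP.
by rewrite eq_sym onee_eq0.
Qed.

Let RI (f : 'rV[R]_d -> R) : R := \int[mu]_(y in Omega) f y.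

Let intO (f : 'rV[R]_d -> R) := mu.-integrable Omega (EFin \o f).

Lemma integrable_bounded_mul (f g : 'rV[R]_d -> R) :
  {within Omega, continuous f} -> intO g -> intO (fun y => f y * g y).
Proof.
move=> cf ig; have [x _ hx] := exists_max_within Omega_neq0 cO cf.
have mf := measurable_fun_within clO cf.
have bf : [bounded f y | y in Omega].
  by exists `|f x|; split => [|M hM y Oy]; [exact: num_real|exact: le_trans (hx y Oy) (ltW hM)].
by have := integrableMr mO mf bf ig.
Qed.

Lemma integrable_within (f : 'rV[R]_d -> R) :
  {within Omega, continuous f} -> intO f.
Proof.
move=> cf; have := integrable_bounded_mul cf (integrable_cstR mu 1 mO).
by rewrite /intO; under eq_fun do rewrite /= mulr1.
Qed.

Lemma intO_ext (f g : 'rV[R]_d -> R) : f = g -> intO f -> intO g.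
Proof. by move=> ->. Qed.

Lemma RI_orth i j : RI (fun y => u i y * u j y) = (i == j)%:R.
Proof. by rewrite /RI /Rintegral orth. Qed.

Lemma RI_lin (J : finType) (w : J -> R) (f : J -> 'rV[R]_d -> R) :
  (forall j, intO (f j)) ->
  RI (fun y => \sum_j w j * f j y) = \sum_j w j * RI (f j).
Proof.
move=> hf; rewrite /RI /Rintegral; under eq_integral do rewrite -sumEFin.
have iw j : intO (fun y => w j * f j y) by exact: (integrableZl mO (w j) (hf j)).
rewrite integral_sum // fine_sum; last first.
  by move=> j; apply: integrable_fin_num => //; exact: iw.
by apply: eq_bigr => j _; have := RintegralZl (w j) mO (hf j).
Qed.

Lemma intO_uu i j : intO (fun y => u i y * u j y).
Proof. by apply: integrable_bounded_mul => //; exact: integrable_within. Qed.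

Lemma spanf_coef c k : RI (fun y => spanf u c y * u k y) = c k.
Proof.
have -> : (fun y => spanf u c y * u k y) = (fun y => \sum_j c j * (u j y * u k y)).
  by apply/funext => y; rewrite mulr_suml; apply: eq_bigr => j _; rewrite mulrA.
rewrite RI_lin => [|j]; last exact: intO_uu.
rewrite (bigD1 k) //= RI_orth eqxx mulr1 big1 ?addr0 // => j jk.
by rewrite RI_orth (negbTE jk) mulr0.
Qed.

(** Coefficients are integrals against the orthonormal basis. This is what makes the quadrature
    error relative to the maximum of |f|. *)
Lemma coef_le c k F B : (forall x, Omega x -> `|spanf u c x| <= F) ->
  (forall x, Omega x -> `|u k x| <= B) -> `|c k| <= F * B.
Proof.
move=> hF hB; rewrite -[c k]spanf_coef.
have ic : intO (fun y => spanf u c y * u k y).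
  apply: integrable_bounded_mul; first exact: within_spanf.
  exact: integrable_within.
apply: le_trans (le_normr_Rintegral mO ic) _.
apply: (@le_trans _ _ (\int[mu]_(y in Omega) (F * B))).
  apply: le_Rintegral => //; first exact: (integrable_norm ic).
    exact: integrable_cstR.
  by move=> y Oy; rewrite normrM ler_pM ?hF ?hB.
rewrite Rintegral_cst // [X in _ * X](_ : _ = 1) ?mulr1 //.
exact: (congr1 fine muO).
Qed.

Lemma Dirichlet_reproducing c x : RI (fun y => Dirichlet u x y * spanf u c y) = spanf u c x.
Proof.
have -> : (fun y => Dirichlet u x y * spanf u c y) =
    (fun y => \sum_j u j x * (spanf u c y * u j y)).
  by apply/funext => y; rewrite mulr_suml; apply: eq_bigr => j _; rewrite -mulrA [u j y * _]mulrC.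
rewrite RI_lin => [|j].
  by apply: eq_bigr => j _; rewrite spanf_coef mulrC.
apply: integrable_bounded_mul; first exact: within_spanf.
exact: integrable_within.
Qed.

Section Kernel.
Variables (M : nat) (w v : 'I_M -> 'rV[R]_d -> R).
Hypothesis cw : forall i, {within Omega, continuous (w i)}.
Hypothesis iv : forall i, intO (v i).
Hypothesis ann : forall f, XN u f -> forall x, Omega x ->
  (\int[mu]_(y in Omega) ((\sum_(i < M) w i x * v i y) * f y)%:E = 0)%E.

Let phi (p : 'I_(M + N)) : 'rV[R]_d -> R :=
  match fintype.split p with inl i => v i | inr j => u j end.

Let eta (p : 'I_(M + N)) : 'rV[R]_d -> R :=
  match fintype.split p with inl i => fun x => - w i x | inr j => u j end.

Let H x y := Dirichlet u x y - \sum_(i < M) w i x * v i y.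

Lemma kernelE x y : H x y = \sum_p eta p x * phi p y.
Proof.
rewrite big_split_ord /= /H [LHS]addrC; congr (_ + _).
  rewrite -sumrN; apply: eq_bigr => i _.
  by rewrite /eta /phi -[lshift _ _]/(unsplit (inl i)) unsplitK mulNr.
apply: eq_bigr => j _.
by rewrite /eta /phi -[rshift _ _]/(unsplit (inr j)) unsplitK.
Qed.

Lemma within_eta p : {within Omega, continuous (eta p)}.
Proof.
rewrite /eta; case: (fintype.split p) => [i|j]; last exact: cu.
by move=> x; apply: (@cvgN _ R^o); exact: cw.
Qed.

Lemma intO_phi p : intO (phi p).
Proof.
rewrite /phi; case: (fintype.split p) => [i|j]; first exact: iv.
exact: integrable_within.
Qed.

Lemma intO_kernel_span c x : intO (fun y => H x y * spanf u c y).
Proof.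
have ih : intO (fun y => H x y).
  apply: (@intO_ext (fun y => \sum_p eta p x * phi p y)).
    by apply/funext => y; rewrite kernelE.
  by apply: integrable_lin => // p; exact: intO_phi.
apply: (@intO_ext (fun y => spanf u c y * H x y)).
  by apply/funext => y; rewrite mulrC.
by apply: integrable_bounded_mul => //; exact: within_spanf.
Qed.

Lemma kernel_reproducing c x : Omega x -> RI (fun y => H x y * spanf u c y) = spanf u c x.
Proof.
move=> Ox; pose W y := \sum_(i < M) w i x * v i y.
have iD : intO (fun y => Dirichlet u x y * spanf u c y).
  apply: integrable_bounded_mul; first exact: within_spanf.
  by apply: integrable_within; exact: within_spanf.
have iW : intO (fun y => W y * spanf u c y).
  apply: (@intO_ext (fun y => spanf u c y * W y)).
    by apply/funext => y; rewrite mulrC.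
  by apply: integrable_bounded_mul; [exact: within_spanf|exact: integrable_lin].
have -> : (fun y => H x y * spanf u c y) =
    (fun y => Dirichlet u x y * spanf u c y - W y * spanf u c y).
  by apply/funext => y; rewrite mulrBl.
rewrite {1}/RI RintegralB // -/(RI _) Dirichlet_reproducing.
rewrite /Rintegral ann ?subr0 //; by exists c.
Qed.

(** The reproducing identity for the function 1. *)
Lemma kernel_norm_ge1 x : Omega x -> 1 <= RI (fun y => `|H x y|).
Proof.
move=> Ox; have [c hc] := one_span.
rewrite -(hc x Ox) -(kernel_reproducing c Ox).
have ik := intO_kernel_span c x.
apply: le_trans (ler_norm _) _; apply: le_trans (le_normr_Rintegral mO ik) _.
rewrite le_eqVlt; apply/orP; left; apply/eqP; apply: eq_Rintegral => y.
by rewrite inE => Oy; rewrite hc // mulr1.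
Qed.

(* Both [H x] and [H x * f] lie in the span of the products [phi_p * u_k],
   the former because 1 is a combination of the [u_k] on [Omega]. *)
Let prods y : 'M[R]_(M + N, N) := \matrix_(p, k) (phi p y * u k y).
Let zmat x (c : 'I_N -> R) : 'M[R]_(M + N, N) := \matrix_(p, k) (eta p x * c k).

Lemma kernel_spanE x c y : H x y * spanf u c y =
  \sum_l (mxvec (zmat x c)) 0 l * (mxvec (prods y)) 0 l.
Proof.
rewrite sum_mxvec kernelE mulr_suml; apply: eq_bigr => p _.
rewrite mulr_sumr; apply: eq_bigr => k _; rewrite !mxE; ring.
Qed.

Lemma intO_prods l : intO (fun y => (mxvec (prods y)) 0 l).
Proof.
case/mxvec_indexP: l => p k; apply: (@intO_ext (fun y => u k y * phi p y)).
  by apply/funext => y; rewrite mxvecE mxE mulrC.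
by apply: integrable_bounded_mul => //; exact: intO_phi.
Qed.

Lemma zmat_norm_le x c B F : Omega x -> 0 <= B ->
  (forall p y, Omega y -> `|eta p y| <= B) ->
  (forall k y, Omega y -> `|u k y| <= B) ->
  (forall y, Omega y -> `|spanf u c y| <= F) ->
  \sum_l `|(mxvec (zmat x c)) 0 l| <= ((M + N) * N)%:R * (B * B) * F.
Proof.
move=> Ox B0 heta hu hF.
apply: (@le_trans _ _ (\sum_(l < (M + N) * N) B * (F * B))).
  apply: ler_sum => l _; case/mxvec_indexP: l => p k; rewrite mxvecE mxE normrM.
  by rewrite ler_pM ?heta //; apply: coef_le => // y Oy; exact: hu.
rewrite sumr_const card_ord -[leLHS]mulr_natl le_eqVlt; apply/orP; left.
by apply/eqP; ring.
Qed.

(** Quadrature and thinning hold for all coefficient vectors at once, and x and f enter only through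
    [zmat x c]; hence one set of points serves every x and f. Thinning is applied to [zmat x c] for
    f and to [zmat x c1] for the function 1. *)
Lemma sampling_recovery (C s : R) :
  (forall (n : nat) (I : finType) (a : I -> 'rV[R]_n) (t : I -> R), (1 < n)%N ->
    (forall k, 0 <= t k) ->
    exists t' : I -> R, [/\ forall k, 0 <= t' k,
      #|[set k | t' k != 0%R]%SET|%:R <= C * n%:R * ln n%:R &
      forall z, `|\sum_k t' k * `|dotp (a k) z| - \sum_k t k * `|dotp (a k) z| |
        <= 1 / 2 * \sum_k t k * `|dotp (a k) z|]) ->
  (1 < (M + N) * N)%N -> 1 <= s ->
  (forall x, Omega x -> RI (fun y => `|H x y|) <= 2 * s) ->
  exists (m : nat) (xi : 'I_m -> 'rV[R]_d), [/\ forall nu, Omega (xi nu),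
    m%:R <= C * ((M + N) * N)%:R * ln ((M + N) * N)%:R &
    forall c x, Omega x ->
      `|spanf u c x| <= 12 * s * \big[Num.max/0]_(nu < m) `|spanf u c (xi nu)|].
Proof.
move=> sparse n1 s1 hs.
have [B1 B10 hB1] := uniform_bound_within Omega_neq0 cO within_eta.
have [B2 B20 hB2] := uniform_bound_within Omega_neq0 cO cu.
pose B := B1 + B2.
have B0 : 0 <= B by rewrite addr_ge0.
have heta p y : Omega y -> `|eta p y| <= B.
  by move=> Oy; apply: le_trans (hB1 p y Oy) _; rewrite lerDl.
have hu k y : Omega y -> `|u k y| <= B.
  by move=> Oy; apply: le_trans (hB2 k y Oy) _; rewrite lerDr.
set n := ((M + N) * N)%N in n1 *.
pose b : R := n%:R * (B * B).
have b0 : 0 <= b by rewrite /b !mulr_ge0.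
(* The coefficient sum of [zmat x c] is at most [b * F], so this [eps] leaves a quadrature error of
   at most F/4. *)
pose eps : R := (4 * (1 + b))^-1.
have eps0 : 0 < eps by rewrite invr_gt0 mulr_gt0 // ltr_pwDl.
have epsb : eps * b <= 1 / 4.
  by rewrite /eps mulrC ler_pdivrMr ?mulr_gt0 ?ltr_pwDl //; lra.
have [I [xi [lam [xiO lam0 hlam]]]] :=
  exists_quadrature mO Omega_neq0 eps0 intO_prods.
pose a k : 'rV[R]_n := mxvec (prods (xi k)).
have [t [t0 tK ht]] := sparse n I a lam n1 lam0.
have dE x c k : `|dotp (a k) (mxvec (zmat x c))| = `|H x (xi k) * spanf u c (xi k)|.
  by rewrite kernel_spanE dotpC.
have quad x c F : Omega x -> (forall y, Omega y -> `|spanf u c y| <= F) ->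
    `|RI (fun y => `|H x y * spanf u c y|) -
      \sum_k lam k * `|H x (xi k) * spanf u c (xi k)| | <= F / 4.
  move=> Ox hF; have := hlam (mxvec (zmat x c)).
  have -> : \int[mu]_(y in Omega) `|\sum_j (mxvec (zmat x c)) 0 j * (mxvec (prods y)) 0 j|
     = RI (fun y => `|H x y * spanf u c y|).
    by apply: eq_Rintegral => y _; rewrite kernel_spanE.
  under [\sum_k lam k * _]eq_bigr do rewrite -kernel_spanE.
  move=> h; apply: le_trans h _.
  have F0 : 0 <= F by have [y Oy] := Omega_neq0; exact: le_trans (hF y Oy).
  apply: le_trans (ler_wpM2l (ltW eps0) (zmat_norm_le Ox B0 heta hu hF)) _.
  by rewrite -/b mulrA; apply: le_trans (ler_wpM2r F0 epsb) _; lra.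
pose supp := [set k | t k != 0%R]%SET.
exists #|supp|, (fun nu => xi (enum_val nu)); split => // c.
set Mx := \big[Num.max/0]_(nu < _) _.
(* At a maximum point of |f| the value [F] is also the bound required by [quad], so the error F/4 is
   absorbed on the left. *)
have [x Ox hx] := exists_max_within Omega_neq0 cO (within_spanf (c := c) cu).
suff : `|spanf u c x| <= 12 * s * Mx by move=> h x' Ox'; exact: le_trans (hx x' Ox') h.
set F := `|spanf u c x| in hx *.
have F0 : 0 <= F by exact: normr_ge0.
have [c1 hc1] := one_span.
have Fle : F <= \sum_k lam k * `|H x (xi k) * spanf u c (xi k)| + F / 4.
  apply: (@le_trans _ _ (RI (fun y => `|H x y * spanf u c y|))).
    rewrite /F -[in leLHS](kernel_reproducing c Ox).
    exact: le_normr_Rintegral (intO_kernel_span c x).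
  by have := quad x c F Ox hx; rewrite ler_norml => /andP[_]; lra.
have lam_t : \sum_k lam k * `|H x (xi k) * spanf u c (xi k)| <=
    2 * \sum_k t k * `|H x (xi k) * spanf u c (xi k)|.
  have := ht (mxvec (zmat x c)).
  under [\sum_k t k * _]eq_bigr do rewrite dE.
  under [\sum_k lam k * _]eq_bigr do rewrite dE.
  by rewrite ler_norml => /andP[+ _]; lra.
have Mx_ge k : k \in supp -> `|spanf u c (xi k)| <= Mx.
  move=> ks; rewrite /Mx.
  have := le_bigmax 0 (fun nu : 'I_#|supp| => `|spanf u c (xi (enum_val nu))|)
    (enum_rank_in ks k).
  by rewrite enum_rankK_in.
have Mx0 : 0 <= Mx by rewrite /Mx; elim/big_rec: _ => // i y _ y0; rewrite le_max y0 orbT.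
have t_Mx : \sum_k t k * `|H x (xi k) * spanf u c (xi k)| <=
    Mx * \sum_k t k * `|H x (xi k) * spanf u c1 (xi k)|.
  rewrite mulr_sumr; apply: ler_sum => k _; rewrite mulrCA.
  have [tk|tk] := eqVneq (t k) 0; first by rewrite tk !mul0r.
  rewrite ler_wpM2l // hc1 // mulr1 normrM mulrC ler_wpM2r //.
  by apply: Mx_ge; rewrite inE.
have t_lam : \sum_k t k * `|H x (xi k) * spanf u c1 (xi k)| <=
    3 / 2 * \sum_k lam k * `|H x (xi k) * spanf u c1 (xi k)|.
  have := ht (mxvec (zmat x c1)).
  under [\sum_k t k * _]eq_bigr do rewrite dE.
  under [\sum_k lam k * _]eq_bigr do rewrite dE.
  by rewrite ler_norml => /andP[_]; lra.
have lam_s : \sum_k lam k * `|H x (xi k) * spanf u c1 (xi k)| <= 2 * s + 1 / 4.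
  have b1 y : Omega y -> `|spanf u c1 y| <= 1 by move=> Oy; rewrite hc1 // normr1.
  have := quad x c1 1 Ox b1; rewrite ler_norml => /andP[+ _].
  have -> : RI (fun y => `|H x y * spanf u c1 y|) = RI (fun y => `|H x y|).
    by apply: eq_Rintegral => y; rewrite inE => Oy; rewrite hc1 // mulr1.
  by have := hs x Ox; lra.
(* As [1 <= s], 3/2 * (2s + 1/4) <= 9/2 * s. The final constant is 12 = 4/3 * 2 * 9/2, with 4/3 from
   absorbing F/4. *)
have : \sum_k t k * `|H x (xi k) * spanf u c1 (xi k)| <= 9 / 2 * s by lra.
move=> /(ler_wpM2l Mx0); lra.
Qed.

End Kernel.
End Recovery.

(** * Lower and upper bounds for the bilinear approximation error *)

Section Sigma.
Variables (R : realType) (d : nat) (Omega : set 'rV[R]_d).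
Variables (mu : probability (BorelRd R d) R) (N : nat) (u : 'I_N -> 'rV[R]_d -> R).
Hypothesis cO : compact Omega.
Hypothesis muO : mu Omega = 1%E.
Hypothesis cu : forall j, {within Omega, continuous (u j)}.
Hypothesis orth : forall i j,
  (\int[mu]_(y in Omega) (u i y * u j y)%:E)%E = ((i == j)%:R)%:E.
Hypothesis one_span : exists c, forall x, Omega x -> spanf u c x = 1.
Variable M : nat.

Let err (W : 'rV[R]_d -> 'rV[R]_d -> R) x : \bar R :=
  (\int[mu]_(y in Omega) (`|Dirichlet u x y - W x y|)%:E)%E.

Let kern (w v : 'I_M -> 'rV[R]_d -> R) x y := \sum_(i < M) w i x * v i y.

Lemma BM_kern W : BM Omega mu u M W -> exists w v,
  [/\ W = kern w v, forall i, {within Omega, continuous (w i)},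
      forall i, mu.-integrable Omega (EFin \o v i) &
      forall f, XN u f -> forall x, Omega x ->
        (\int[mu]_(y in Omega) (kern w v x y * f y)%:E = 0)%E].
Proof.
move=> [w [v [cw iv WE ann]]].
have E : W = kern w v by apply/funext => x; apply/funext => y; rewrite WE.
by exists w, v; split => //; rewrite -E.
Qed.

Lemma err_fin w v x : (forall i, mu.-integrable Omega (EFin \o v i)) ->
  err (kern w v) x = (\int[mu]_(y in Omega) `|Dirichlet u x y - kern w v x y|)%:E.
Proof.
move=> iv; rewrite /Rintegral fineK //.
have mO : measurable (Omega : set (BorelRd R d)).
  by apply: closed_measurable_Rd; apply: compact_closed => //; exact: norm_hausdorff.
have iH : mu.-integrable Omega
    (EFin \o (fun y => Dirichlet u x y - kern w v x y)).
  have iD : mu.-integrable Omega (EFin \o (fun y => Dirichlet u x y)).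
    apply: integrable_lin => // j; exact: (integrable_within cO muO).
  have iW : mu.-integrable Omega (EFin \o (fun y => kern w v x y)).
    exact: integrable_lin.
  have := integrableB mO iD iW.
  by congr (_.-integrable _ _).
exact: (integrable_fin_num mO (integrable_norm iH)).
Qed.

Lemma BM_zero : BM Omega mu u M (fun _ _ => 0).
Proof.
exists (fun _ _ => 0), (fun _ _ => 0); split.
- by move=> i; exact: cst_continuous.
- by move=> i; have := integrable0 mu Omega.
- by move=> x y; rewrite big1 // => i _; rewrite mul0r.
- by move=> f _ x _; under eq_integral do rewrite mul0r; rewrite integral0.
Qed.

Lemma sigmaMc_ge1 : (1 <= sigmaMc Omega mu u M (Dirichlet u))%E.
Proof.
apply: le_ereal_inf_tmp => _ [W /BM_kern[w [v [-> cw iv ann]]] <-].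
have [x Ox] := Omega_neq0 muO.
apply: (@le_trans _ _ (err (kern w v) x)); last by apply: ereal_sup_ubound; exists x.
by rewrite err_fin // lee_fin; exact: (kernel_norm_ge1 cO muO cu orth one_span).
Qed.

(** Tested on W = 0. Finiteness of the infimum is what provides a near-optimal W. *)
Lemma sigmaMc_lty : (sigmaMc Omega mu u M (Dirichlet u) < +oo)%E.
Proof.
have mO : measurable (Omega : set (BorelRd R d)).
  by apply: closed_measurable_Rd; apply: compact_closed => //; exact: norm_hausdorff.
have [B B0 hB] := uniform_bound_within (Omega_neq0 muO) cO cu.
apply: (@le_lt_trans _ _ (N%:R * (B * B))%:E); last exact: ltry.
apply: le_trans (ereal_inf_lbound _) _; first by exists (fun _ _ => 0); [exact: BM_zero|].
apply: ge_ereal_sup => _ [x Ox <-].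
have [w [v [E _ iv _]]] := BM_kern BM_zero.
rewrite -[leLHS]/(err (fun _ _ => 0) x) E err_fin // lee_fin -E.
apply: (@le_trans _ _ (\int[mu]_(y in Omega) (N%:R * (B * B)))).
  apply: le_Rintegral => //; last first.
  - move=> y Oy; rewrite subr0; apply: le_trans (ler_norm_sum _ _ _) _.
    apply: (@le_trans _ _ (\sum_(j < N) B * B)).
      by apply: ler_sum => j _; rewrite normrM ler_pM // hB.
    by rewrite sumr_const card_ord -[leLHS]mulr_natl.
  - exact: integrable_cstR.
  under eq_fun do rewrite subr0.
  apply: integrable_norm; apply: integrable_lin => // j.
  exact: (integrable_within cO muO).
by rewrite Rintegral_cst // [X in _ * X](_ : _ = 1) ?mulr1 //; exact: (congr1 fine muO).
Qed.

End Sigma.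

(** The space is given by an orthonormal basis [u]. For [(M + N) * N = 1] the logarithm vanishes and
    the bound on [m] would leave no point. *)
Theorem theorem3p3 (R : realType) :
  exists C1 C2 : R, 0 < C1 /\ 0 < C2 /\
  forall (d : nat) (Omega : set 'rV[R]_d) (mu : probability (BorelRd R d) R)
         (N : nat) (u : 'I_N -> 'rV[R]_d -> R) (M : nat),
    compact Omega ->
    mu Omega = 1%E ->
    (forall j, {within Omega, continuous (u j)}) ->
    (forall i j, (\int[mu]_(y in Omega) (u i y * u j y)%:E)%E = ((i == j)%:R)%:E) ->
    (exists c, forall x, Omega x -> spanf u c x = 1) ->
    (1 < (M + N) * N)%N ->
    exists (m : nat) (xi : 'I_m -> 'rV[R]_d),
      (forall nu, Omega (xi nu)) /\
      (m%:R <= C1 * ((M + N) * N)%:R * ln ((M + N) * N)%:R) /\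
      forall f, XN u f ->
        (supnorm Omega f <=
         C2%:E * sigmaMc Omega mu u M (Dirichlet u)
               * (\big[Num.max/0]_(nu < m) `|f (xi nu)|)%:E)%E.
Proof.
have [C C0 sparse] := sparsify R.
exists C, 12; split => //; split => // d Omega mu N u M cO muO cu orth one n1.
have sg1 := sigmaMc_ge1 cO muO cu orth one M.
have sgf : (sigmaMc Omega mu u M (Dirichlet u) \is a fin_num)%E.
  by rewrite ge0_fin_numE ?(sigmaMc_lty cO muO cu) // (le_trans _ sg1).
(* An additive slack of 1 is within a factor 2, since sigma is at least 1. *)
have [_ [W BW <-] Wlt] := lb_ereal_inf_adherent ltr01 sgf.
pose s := fine (sigmaMc Omega mu u M (Dirichlet u)).
have sE : sigmaMc Omega mu u M (Dirichlet u) = s%:E by rewrite fineK.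
have s1 : 1 <= s by rewrite -lee_fin -sE.
have [w [v [WE cw iv ann]]] := BM_kern BW.
have hs x : Omega x ->
    \int[mu]_(y in Omega) `|Dirichlet u x y - \sum_(i < M) w i x * v i y| <= 2 * s.
  move=> Ox; have E := @err_fin R d Omega mu N u cO muO cu M w v x iv.
  rewrite -lee_fin -E.
  apply: (@le_trans _ _ (s + 1)%:E); last by rewrite lee_fin; lra.
  rewrite EFinD -sE; apply: ltW; apply: le_lt_trans Wlt.
  rewrite WE.
  by apply: ereal_sup_ubound; exists x.
have [m [xi [xiO mC hm]]] := sampling_recovery cO muO cu orth one cw iv ann sparse n1 s1 hs.
exists m, xi; split => //; split => // _ [c ->].
rewrite sE -!EFinM; apply: ge_ereal_sup => _ [x Ox <-].
by rewrite lee_fin; exact: hm.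
Qed.
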